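(* The derivability problems for each of the multiplicative fragments $\mathcal{M}'^{\,\mathrm{mult}}_{2015}$, $\mathcal{M}'^{\,\mathrm{mult}}_{2018}$ and $\mathcal{M}'^{-,\mathrm{mult}}_{2018}$ of the calculi with stoups defined below are algorithmically undecidable.
   Context: Formulae are built from a countable set of variables and the constant $\mathbf{1}$ by the binary connectives $\backslash$, $/$, $\cdot$, $\wedge$, $\vee$ and the unary connectives $\langle\rangle$, $[]^{-1}$ and $!$. A stoup is a finite multiset of formulae ($\varnothing$ empty). A tree term is a formula or $[\Xi]$ with $\Xi$ a meta-formula; a meta-formula is $\zeta;\Gamma$ with $\zeta$ a stoup and $\Gamma$ a finite linearly ordered sequence of tree terms (empty sequence $\Lambda$); $\varnothing;\Gamma$ is written $\Gamma$. Comma denotes concatenation of sequences and multiset union of stoups; $\zeta,A$ adds a copy of $A$. A sequent is $\Xi\to C$. $\Xi(\Theta)$ denotes a meta-formula with a designated occurrence of a meta-formula $\Theta$ which is $\Xi$ itself or the content of some bracket $[\Theta]$ at any depth; $\Xi(\Theta')$ is the result of replacement. Common axioms and rules: $A\to A$, $\Lambda\to\mathbf1$; ($/L$) from $\zeta_1;\Gamma\to B$ and $\Xi(\zeta_2;\Delta_1,C,\Delta_2)\to D$ infer $\Xi(\zeta_1,\zeta_2;\Delta_1,C/B,\Gamma,\Delta_2)\to D$; ($/R$) from $\zeta;\Gamma,B\to C$ infer $\zeta;\Gamma\to C/B$; ($\backslash L$) from $\zeta_1;\Gamma\to A$ and $\Xi(\zeta_2;\Delta_1,C,\Delta_2)\to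 D$ infer $\Xi(\zeta_1,\zeta_2;\Delta_1,\Gamma,A\backslash C,\Delta_2)\to D$; ($\backslash R$) from $\zeta;A,\Gamma\to C$ infer $\zeta;\Gamma\to A\backslash C$; ($\cdot L$) from $\Xi(\zeta;\Delta_1,A,B,\Delta_2)\to D$ infer $\Xi(\zeta;\Delta_1,A\cdot B,\Delta_2)\to D$; ($\cdot R$) from $\zeta_1;\Delta\to A$ and $\zeta_2;\Gamma\to B$ infer $\zeta_1,\zeta_2;\Delta,\Gamma\to A\cdot B$; ($\mathbf1L$) from $\Xi(\zeta;\Delta_1,\Delta_2)\to A$ infer $\Xi(\zeta;\Delta_1,\mathbf1,\Delta_2)\to A$; ($\vee L$), ($\vee R_i$), ($\wedge L_i$), ($\wedge R$) as usual with the context $\Xi(\zeta;\Delta_1,\cdot,\Delta_2)$ for left rules (from $\Xi(\zeta;\Delta_1,A_1,\Delta_2)\to C$ and $\Xi(\zeta;\Delta_1,A_2,\Delta_2)\to C$ infer $\Xi(\zeta;\Delta_1,A_1\vee A_2,\Delta_2)\to C$; from $\Xi\to A_i$ infer $\Xi\to A_1\vee A_2$; from $\Xi(\zeta;\Delta_1,A_i,\Delta_2)\to C$ infer $\Xi(\zeta;\Delta_1,A_1\wedge A_2,\Delta_2)\to C$; from $\Xi\to A_1$ and $\Xi\to A_2$ infer $\Xi\to A_1\wedge A_2$); ($[]^{-1}L$) from $\Xi(\zeta;\Delta_1,A,\Delta_2)\to B$ infer $\Xi(\zeta;\Delta_1,[[]^{-1}A],\Delta_2)\to B$; ($[]^{-1}R$)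 from $[\Xi]\to A$ infer $\Xi\to[]^{-1}A$; ($\langle\rangle L$) from $\Xi(\zeta;\Delta_1,[A],\Delta_2)\to B$ infer $\Xi(\zeta;\Delta_1,\langle\rangle A,\Delta_2)\to B$; ($\langle\rangle R$) from $\Xi\to A$ infer $[\Xi]\to\langle\rangle A$; ($!L$) from $\Xi(\zeta,A;\Gamma_1,\Gamma_2)\to B$ infer $\Xi(\zeta;\Gamma_1,!A,\Gamma_2)\to B$; ($!P$) from $\Xi(\zeta;\Gamma_1,A,\Gamma_2)\to B$ infer $\Xi(\zeta,A;\Gamma_1,\Gamma_2)\to B$. $\mathcal{M}'_{2015}$: common rules plus ($!R'$) from $\zeta;\Lambda\to B$ infer $\zeta;\Lambda\to!B$ if $\zeta\ne\varnothing$, and ($!C'$) from $\Xi(\zeta_1,\zeta_2;\Gamma_1,[\zeta',\zeta_2;\Gamma_2],\Gamma_3)\to C$ infer $\Xi(\zeta_1,\zeta_2,\zeta';\Gamma_1,\Gamma_2,\Gamma_3)\to C$ if $\zeta_2\neq\varnothing$. $\mathcal{M}'_{2018}$: common rules plus ($!R'$) from $A;\Lambda\to B$ infer $A;\Lambda\to!B$, and ($!C'$) from $\Xi(\zeta,A;\Gamma_1,[\zeta',A;\Gamma_2],\Gamma_3)\to B$ infer $\Xi(\zeta,A;\Gamma_1,[[\zeta';\Gamma_2]],\Gamma_3)\to B$. $\mathcal{M}'^{-}_{2018}$: $\mathcal{M}'_{2018}$ restricted to formulae without $\mathbf1$, without $\Lambda\to\mathbf1$ and $\mathbf1L$, with $\backslash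 R,/R$ allowed only if $\Gamma\ne\Lambda$ or $\zeta\neq\varnothing$, and $!C'$ only if $\Gamma_2\ne\Lambda$ or $\zeta'\ne\varnothing$. Cut is not a rule. The multiplicative fragment (superscript $\mathrm{mult}$) uses only formulae without $\wedge,\vee$ and omits their rules. *)

(* Defs.v *)
From Stdlib Require Import List Permutation Arith Bool.
Import ListNotations.

(* Formulae over variables indexed by nat.
   FUnder A C = A \ C ;  FOver C B = C / B ;  FDia = <> ;  FBoxI = []^{-1}. *)
Inductive formula : Type :=
| FVar (n : nat)
| FOne
| FUnder (A C : formula)
| FOver (C B : formula)
| FProd (A B : formula)
| FAnd (A B : formula)
| FOr (A B : formula)
| FDia (A : formula)
| FBoxI (A : formula)
| FBang (A : formula).

(* Tree terms: a formula, or a bracket [zeta; Gamma].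
   Stoups (finite multisets) are represented by lists; multiset semantics is
   recovered by the structural rule [d_perm] below. *)
Inductive tterm : Type :=
| TFor (A : formula)
| TBr (z : list formula) (G : list tterm).

Definition meta : Type := (list formula * list tterm)%type.
Definition sequent : Type := (meta * formula)%type.

Inductive ctx : Type :=
| CHole
| CIn (z : list formula) (G1 : list tterm) (c : ctx) (G2 : list tterm).

Fixpoint fill (c : ctx) (m : meta) : meta :=
  match c with
  | CHole => m
  | CIn z G1 c' G2 => let m' := fill c' m in (z, G1 ++ TBr (fst m') (snd m') :: G2)
  end.

Inductive teq : tterm -> tterm -> Prop :=
| teq_for A : teq (TFor A) (TFor A)
| teq_br z z' G G' : Permutation z z' -> Forall2 teq G G' -> teq (TBr z G) (TBr z' G').

Definition meq (m m' : meta) : Prop :=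
  Permutation (fst m) (fst m') /\ Forall2 teq (snd m) (snd m').

Inductive system : Type := S2015 | S2018 | S2018minus.

Inductive deriv (s : system) : sequent -> Prop :=
| d_ax A : deriv s (([], [TFor A]), A)
| d_one : s <> S2018minus -> deriv s (([], []), FOne)
| d_overL c z1 z2 G D1 D2 B C E :
    deriv s ((z1, G), B) ->
    deriv s (fill c (z2, D1 ++ TFor C :: D2), E) ->
    deriv s (fill c (z1 ++ z2, D1 ++ TFor (FOver C B) :: G ++ D2), E)
| d_overR z G B C :
    (s = S2018minus -> G <> [] \/ z <> []) ->
    deriv s ((z, G ++ [TFor B]), C) ->
    deriv s ((z, G), FOver C B)
| d_underL c z1 z2 G D1 D2 A C E :
    deriv s ((z1, G), A) ->
    deriv s (fill c (z2, D1 ++ TFor C :: D2), E) ->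
    deriv s (fill c (z1 ++ z2, D1 ++ G ++ TFor (FUnder A C) :: D2), E)
| d_underR z G A C :
    (s = S2018minus -> G <> [] \/ z <> []) ->
    deriv s ((z, TFor A :: G), C) ->
    deriv s ((z, G), FUnder A C)
| d_prodL c z D1 D2 A B E :
    deriv s (fill c (z, D1 ++ TFor A :: TFor B :: D2), E) ->
    deriv s (fill c (z, D1 ++ TFor (FProd A B) :: D2), E)
| d_prodR z1 z2 D G A B :
    deriv s ((z1, D), A) -> deriv s ((z2, G), B) ->
    deriv s ((z1 ++ z2, D ++ G), FProd A B)
| d_oneL c z D1 D2 A :
    s <> S2018minus ->
    deriv s (fill c (z, D1 ++ D2), A) ->
    deriv s (fill c (z, D1 ++ TFor FOne :: D2), A)
| d_boxiL c z D1 D2 A B :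
    deriv s (fill c (z, D1 ++ TFor A :: D2), B) ->
    deriv s (fill c (z, D1 ++ TBr [] [TFor (FBoxI A)] :: D2), B)
| d_boxiR (m : meta) A :
    deriv s (([], [TBr (fst m) (snd m)]), A) ->
    deriv s (m, FBoxI A)
| d_diaL c z D1 D2 A B :
    deriv s (fill c (z, D1 ++ TBr [] [TFor A] :: D2), B) ->
    deriv s (fill c (z, D1 ++ TFor (FDia A) :: D2), B)
| d_diaR (m : meta) A :
    deriv s (m, A) ->
    deriv s (([], [TBr (fst m) (snd m)]), FDia A)
| d_bangL c z G1 G2 A B :
    deriv s (fill c (z ++ [A], G1 ++ G2), B) ->
    deriv s (fill c (z, G1 ++ TFor (FBang A) :: G2), B)
| d_bangP c z G1 G2 A B :
    deriv s (fill c (z, G1 ++ TFor A :: G2), B) ->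
    deriv s (fill c (z ++ [A], G1 ++ G2), B)
| d_bangR2015 z B :
    s = S2015 -> z <> [] ->
    deriv s ((z, []), B) ->
    deriv s ((z, []), FBang B)
| d_bangR2018 A B :
    s <> S2015 ->
    deriv s (([A], []), B) ->
    deriv s (([A], []), FBang B)
| d_bangC2015 c z1 z2 z' G1 G2 G3 C :
    s = S2015 -> z2 <> [] ->
    deriv s (fill c (z1 ++ z2, G1 ++ TBr (z' ++ z2) G2 :: G3), C) ->
    deriv s (fill c (z1 ++ z2 ++ z', G1 ++ G2 ++ G3), C)
| d_bangC2018 c z z' A G1 G2 G3 B :
    s <> S2015 ->
    (s = S2018minus -> G2 <> [] \/ z' <> []) ->
    deriv s (fill c (z ++ [A], G1 ++ TBr (z' ++ [A]) G2 :: G3), B) ->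
    deriv s (fill c (z ++ [A], G1 ++ TBr [] [TBr z' G2] :: G3), B)
(* stoups are multisets *)
| d_perm (m m' : meta) C :
    deriv s (m, C) -> meq m m' -> deriv s (m', C).

Fixpoint fok (one_ok : bool) (A : formula) : bool :=
  match A with
  | FVar _ => true
  | FOne => one_ok
  | FUnder A B | FOver A B | FProd A B => fok one_ok A && fok one_ok B
  | FAnd _ _ | FOr _ _ => false
  | FDia A | FBoxI A | FBang A => fok one_ok A
  end.

Fixpoint tok (one_ok : bool) (t : tterm) : bool :=
  match t with
  | TFor A => fok one_ok A
  | TBr z G => forallb (fok one_ok) z &&
      (fix go (l : list tterm) : bool :=
         match l with [] => true | x :: l' => tok one_ok x && go l' end) G
  end.

Definition one_allowed (s : system) : bool :=
  match s with S2018minus => false | _ => true end.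

Definition in_fragment (s : system) (q : sequent) : Prop :=
  let '((z, G), C) := q in
  forallb (fok (one_allowed s)) z = true /\
  forallb (tok (one_allowed s)) G = true /\
  fok (one_allowed s) C = true.

Definition cpair (a b : nat) : nat := (a + b) * (a + b + 1) / 2 + b.

Fixpoint enc_f (A : formula) : nat :=
  match A with
  | FVar n => cpair 0 n
  | FOne => cpair 1 0
  | FUnder A B => cpair 2 (cpair (enc_f A) (enc_f B))
  | FOver A B => cpair 3 (cpair (enc_f A) (enc_f B))
  | FProd A B => cpair 4 (cpair (enc_f A) (enc_f B))
  | FAnd A B => cpair 5 (cpair (enc_f A) (enc_f B))
  | FOr A B => cpair 6 (cpair (enc_f A) (enc_f B))
  | FDia A => cpair 7 (enc_f A)
  | FBoxI A => cpair 8 (enc_f A)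
  | FBang A => cpair 9 (enc_f A)
  end.

Fixpoint enc_list {X} (e : X -> nat) (l : list X) : nat :=
  match l with [] => 0 | x :: l' => S (cpair (e x) (enc_list e l')) end.

Fixpoint enc_t (t : tterm) : nat :=
  match t with
  | TFor A => cpair 0 (enc_f A)
  | TBr z G => cpair 1 (cpair (enc_list enc_f z)
      ((fix go (l : list tterm) : nat :=
          match l with [] => 0 | x :: l' => S (cpair (enc_t x) (go l')) end) G))
  end.

Definition enc_seq (q : sequent) : nat :=
  let '((z, G), C) := q in cpair (cpair (enc_list enc_f z) (enc_list enc_t G)) (enc_f C).

Inductive instr : Type :=
| Inc (r : nat)
| Dec (r : nat) (j : nat).

Definition program := list instr.
Definition config : Type := (nat * (nat -> nat))%type.

Definition upd (regs : nat -> nat) (r v : nat) : nat -> nat :=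
  fun x => if Nat.eqb x r then v else regs x.

Definition step (p : program) (c : config) : config :=
  let '(pc, regs) := c in
  match nth_error p pc with
  | None => c
  | Some (Inc r) => (S pc, upd regs r (S (regs r)))
  | Some (Dec r j) =>
      match regs r with
      | 0 => (j, regs)
      | S v => (S pc, upd regs r v)
      end
  end.

Fixpoint run (p : program) (k : nat) (c : config) : config :=
  match k with 0 => c | S k' => run p k' (step p c) end.

Definition halted (p : program) (c : config) : Prop := length p <= fst c.

Definition init (n : nat) : config := (0, fun r => if Nat.eqb r 0 then n else 0).

Definition decides_at (p : program) (n : nat) (b : Prop) : Prop :=
  exists k, let c := run p k (init n) in
    halted p c /\ (b -> snd c 0 = 1) /\ (~ b -> snd c 0 = 0).

Definition derivability_decidable (s : system) : Prop :=
  exists p : program, forall q : sequent,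
    in_fragment s q -> decides_at p (enc_seq q) (deriv s q).

(* Main.v *)
From Stdlib Require Import List Permutation Arith Bool Lia FunctionalExtensionality.
Import ListNotations.
Require Import Defs.

(** A counter machine [p] on input [n] is turned into a sequent [w -> !R_1 \ ... !R_m \ G]
    whose antecedent spells the initial configuration and whose [R_i], of the shape
    [q \ []^{-1} (l \ (v / r))], are the rewriting rules [l q r => v] of [p]. Contraction
    puts a copy of [R_i] into a bracket around the state [q], and the [[]^{-1}] removes
    this bracket again. So halting gives a derivation. For the converse, erase all
    brackets: every rule is then sound in the residuated lattice of closed sets of words,
    closed with respect to the words whose computation halts.

    The succedent is a formula that depends on [p] but not on [n], and the code of the
    sequent is a simple function of [n] and of the code of this formula. A decider therefore
    yields a machine that, given [n], computes the code of the sequent with antecedent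
    input [n] and succedent code [n], and halts iff it is underivable; run on the code of
    its own formula, it contradicts itself. *)

(** * Counter machines *)

Definition halts (p : program) (c : config) : Prop := exists k, halted p (run p k c).

Lemma run_add p k l c : run p (k + l) c = run p l (run p k c).
Proof. revert c; induction k as [|k IH]; intros c; simpl; auto. Qed.

Lemma step_halted p c : halted p c -> step p c = c.
Proof.
  destruct c as [pc s]; unfold halted; simpl; intros H.
  now rewrite (proj2 (nth_error_None p pc) H).
Qed.

Lemma run_halted p k c : halted p c -> run p k c = c.
Proof.
  intros H; induction k as [|k IH]; simpl; auto. now rewrite step_halted.
Qed.

Lemma halts_run p k c : halts p c <-> halts p (run p k c).
Proof.
  split; intros [l H].
  - exists l. rewrite <- run_add, Nat.add_comm, run_add.
    now rewrite run_halted.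
  - exists (k + l). now rewrite run_add.
Qed.

Lemma halts_step p c : halts p c <-> halts p (step p c).
Proof. apply (halts_run p 1). Qed.

(** All counters from [length p] on are halted; identifying them leaves finitely many states to
    encode. *)
Definition clamp (p : program) (i : nat) : nat := Nat.min i (length p).

Lemma halts_clamp p i s : halts p (clamp p i, s) <-> halts p (i, s).
Proof.
  unfold clamp. destruct (Nat.le_gt_cases (length p) i) as [H|H].
  - split; intros _; exists 0; unfold halted; simpl; lia.
  - now rewrite Nat.min_l by lia.
Qed.

(** * A loop language and its compilation *)

Inductive cmd : Type :=
| CSkip
| CInc (r : nat)
| CSeq (c d : cmd)
| CLoop (r : nat) (b : cmd).

(** A relation, because a loop body may increment its own loop register, as in [tri_cmd], so that
    loops need not terminate. *)
Inductive exec : cmd -> (nat -> nat) -> (nat -> nat) -> Prop :=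
| exec_skip s : exec CSkip s s
| exec_inc r s : exec (CInc r) s (upd s r (S (s r)))
| exec_seq c d s1 s2 s3 : exec c s1 s2 -> exec d s2 s3 -> exec (CSeq c d) s1 s3
| exec_loop_end r b s : s r = 0 -> exec (CLoop r b) s s
| exec_loop_next r b s1 s2 s3 v :
    s1 r = S v -> exec b (upd s1 r v) s2 -> exec (CLoop r b) s2 s3 ->
    exec (CLoop r b) s1 s3.

Fixpoint size (c : cmd) : nat :=
  match c with
  | CSkip => 0
  | CInc _ => 1
  | CSeq c d => size c + size d
  | CLoop _ b => S (S (size b))
  end.

(* Register [j] is kept at zero, so that [Dec j a] is an unconditional jump to [a]. *)
Fixpoint compile (j a : nat) (c : cmd) : program :=
  match c with
  | CSkip => []
  | CInc r => [Inc r]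
  | CSeq c d => compile j a c ++ compile j (a + size c) d
  | CLoop r b => Dec r (a + S (S (size b))) :: compile j (S a) b ++ [Dec j a]
  end.

Fixpoint avoids (j : nat) (c : cmd) : Prop :=
  match c with
  | CSkip => True
  | CInc r => r <> j
  | CSeq c d => avoids j c /\ avoids j d
  | CLoop r b => r <> j /\ avoids j b
  end.

Lemma compile_length j a c : length (compile j a c) = size c.
Proof.
  revert a; induction c; intros a; simpl; auto.
  - now rewrite length_app, IHc1, IHc2.
  - rewrite length_app, IHc; simpl; lia.
Qed.

Lemma upd_same s r v : upd s r v r = v.
Proof. unfold upd. now rewrite Nat.eqb_refl. Qed.

Lemma upd_other s r v x : x <> r -> upd s r v x = s x.
Proof. intros H. unfold upd. now rewrite (proj2 (Nat.eqb_neq x r) H). Qed.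

Lemma exec_avoids j c s s' : exec c s s' -> avoids j c -> s' j = s j.
Proof.
  induction 1; simpl; intros Ha; auto.
  - apply upd_other; auto.
  - destruct Ha. rewrite IHexec2; auto.
  - destruct Ha as [Hr Hb]. rewrite (IHexec2 (conj Hr Hb)), (IHexec1 Hb). apply upd_other; auto.
Qed.

Definition reaches (p : program) (c c' : config) : Prop := exists k, run p k c = c'.

Lemma reaches_trans p c1 c2 c3 : reaches p c1 c2 -> reaches p c2 c3 -> reaches p c1 c3.
Proof. intros [k <-] [l <-]. exists (k + l). apply run_add. Qed.

Lemma reaches_step p c : reaches p c (step p c).
Proof. now exists 1. Qed.

Lemma reaches_refl p c : reaches p c c.
Proof. now exists 0. Qed.

Lemma nth_error_mid {X} (l : list X) x m : nth_error (l ++ x :: m) (length l) = Some x.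
Proof. rewrite nth_error_app2, Nat.sub_diag by auto. reflexivity. Qed.

(** Jump targets are absolute, so the code sits at address [length l] of an arbitrary program; for
    each subcommand only the split into [l] and [m] moves. *)
Lemma exec_reaches j c s s' :
  exec c s s' -> avoids j c -> s j = 0 ->
  forall p l m, p = l ++ compile j (length l) c ++ m ->
  reaches p (length l, s) (length l + size c, s').
Proof.
  induction 1; simpl; intros Ha Hj p l m Hp.
  - rewrite Nat.add_0_r. apply reaches_refl.
  - replace (length l + 1, _) with (step p (length l, s)); [apply reaches_step|].
    simpl. rewrite Hp; simpl. rewrite nth_error_mid. now rewrite Nat.add_1_r.
  - destruct Ha as [Hc Hd].
    eapply reaches_trans.
    + eapply (IHexec1 Hc Hj p l (compile j (length l + size c) d ++ m)).
      now rewrite Hp, <- app_assoc.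
    + specialize (IHexec2 Hd).
      rewrite (exec_avoids j c s1 s2) in IHexec2 by auto.
      specialize (IHexec2 Hj p (l ++ compile j (length l) c) m).
      rewrite length_app, compile_length in IHexec2.
      rewrite Nat.add_assoc. apply IHexec2.
      now rewrite Hp, <- !app_assoc.
  - replace (length l + _, s) with (step p (length l, s)); [apply reaches_step|].
    simpl. rewrite Hp; simpl. rewrite nth_error_mid. now rewrite H.
  - destruct Ha as [Hr Hb].
    assert (Hs2 : s2 j = 0).
    { rewrite (exec_avoids j b _ _ H0 Hb), upd_other; auto. }
    eapply reaches_trans; [apply reaches_step|].
    replace (step p (length l, s1)) with (S (length l), upd s1 r v).
    2:{ simpl. rewrite Hp; simpl. rewrite nth_error_mid. now rewrite H. }
    specialize (IHexec1 Hb).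
    rewrite upd_other in IHexec1 by auto.
    specialize (IHexec1 Hj p (l ++ [Dec r (length l + S (S (size b)))]) (Dec j (length l) :: m)).
    rewrite length_app, Nat.add_1_r in IHexec1.
    eapply reaches_trans.
    + apply IHexec1. rewrite Hp. simpl. now rewrite <- !app_assoc.
    + eapply reaches_trans; [apply reaches_step|].
      (* The jump back closing the loop: the body avoids register [j], which is therefore still
         zero. *)
      replace (step p (S (length l) + size b, s2)) with (length l, s2).
      * now apply (IHexec2 (conj Hr Hb) Hs2 p l m).
      * unfold step.
        replace (nth_error p (S (length l) + size b)) with (Some (Dec j (length l))).
        -- now rewrite Hs2.
        -- symmetry.
           replace (S (length l) + size b) with
             (length (l ++ Dec r (length l + S (S (size b))) :: compile j (S (length l)) b)).
           2:{ rewrite length_app. simpl. rewrite compile_length. lia. }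
           set (n := length _).
           replace p with
             ((l ++ Dec r (length l + S (S (size b))) :: compile j (S (length l)) b)
               ++ Dec j (length l) :: m).
           ++ apply nth_error_mid.
           ++ rewrite Hp, <- !app_assoc. reflexivity.
Qed.

(** * Computing the code of a sequent *)

(** Seven working registers. The others are zero, among them register 7, which serves as jump
    register. *)
Definition regs7 (a b c d e f g : nat) : nat -> nat :=
  fun r => match r with
  | 0 => a | 1 => b | 2 => c | 3 => d | 4 => e | 5 => f | 6 => g | _ => 0
  end.

Ltac regs_eq :=
  let r := fresh in
  extensionality r; unfold upd, regs7; do 7 (destruct r as [|r]; [reflexivity|]);
  reflexivity.

Ltac exec_inc :=
  match goal with
  | |- exec (CInc ?r) ?s ?s' =>
      replace s' with (upd s r (S (s r))) by (simpl; regs_eq); apply exec_inc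
  end.

Ltac exec_next :=
  eapply exec_loop_next; [simpl; reflexivity | |].

Ltac exec_end := apply exec_loop_end; reflexivity.

Fixpoint incs (r k : nat) : cmd :=
  match k with 0 => CSkip | S k => CSeq (CInc r) (incs r k) end.

(** The triangular numbers in the Cantor pairing [cpair]. *)
Definition tri (k : nat) : nat := k * (k + 1) / 2.

Lemma tri_S k : tri (S k) = S k + tri k.
Proof.
  unfold tri.
  replace (S k * (S k + 1)) with (S k * 2 + k * (k + 1)) by lia.
  rewrite Nat.div_add_l by lia. reflexivity.
Qed.

Lemma cpair_tri a b : cpair a b = tri (a + b) + b.
Proof. reflexivity. Qed.

(** Adds [tri] of register 2 to register 3. Each round lowers register 2 to some [c] and adds [S c];
    register 4 serves to restore [c]. *)
Definition tri_cmd : cmd :=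
  CLoop 2 (CSeq (CInc 3) (CSeq (CLoop 2 (CSeq (CInc 4) (CInc 3))) (CLoop 4 (CInc 2)))).

Ltac norm_upd :=
  match goal with
  | |- exec _ (upd (regs7 ?a ?b ?c ?d ?e ?f ?g) ?r ?v) _ =>
    let s := eval cbv beta iota delta [Nat.eqb] in
      (match r with
       | 0 => regs7 v b c d e f g | 1 => regs7 a v c d e f g
       | 2 => regs7 a b v d e f g | 3 => regs7 a b c v e f g
       | 4 => regs7 a b c d v f g | 5 => regs7 a b c d e v g
       | _ => regs7 a b c d e f v end) in
    replace (upd (regs7 a b c d e f g) r v) with s by regs_eq
  end.

Ltac next := exec_next; [norm_upd |].

Lemma exec_incs_2 k a b c d e f g :
  exec (incs 2 k) (regs7 a b c d e f g) (regs7 a b (k + c) d e f g).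
Proof.
  revert c; induction k as [|k IH]; intros c; simpl; [constructor|].
  eapply exec_seq with (regs7 a b (S c) d e f g); [exec_inc|].
  replace (S (k + c)) with (k + S c) by lia. apply IH.
Qed.

Lemma exec_loop_24 a b c d e f g :
  exec (CLoop 2 (CSeq (CInc 4) (CInc 3))) (regs7 a b c d e f g)
    (regs7 a b 0 (c + d) (c + e) f g).
Proof.
  revert d e; induction c as [|c IH]; intros d e; [exec_end|].
  next.
  - eapply exec_seq with (regs7 a b c d (S e) f g); [exec_inc|].
    instantiate (1 := regs7 a b c (S d) (S e) f g). exec_inc.
  - replace (S c + d) with (c + S d) by lia.
    replace (S c + e) with (c + S e) by lia. apply IH.
Qed.

Lemma exec_loop_42 a b c d e f g :
  exec (CLoop 4 (CInc 2)) (regs7 a b c d e f g) (regs7 a b (e + c) d 0 f g).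
Proof.
  revert c; induction e as [|e IH]; intros c; [exec_end|].
  next.
  - instantiate (1 := regs7 a b (S c) d e f g). exec_inc.
  - replace (S e + c) with (e + S c) by lia. apply IH.
Qed.

Lemma exec_tri a b c d f g :
  exec tri_cmd (regs7 a b c d 0 f g) (regs7 a b 0 (d + tri c) 0 f g).
Proof.
  revert d; induction c as [|c IH]; intros d.
  - replace (d + tri 0) with d by (unfold tri; simpl; lia). exec_end.
  - next.
    + eapply exec_seq with (regs7 a b c (S d) 0 f g); [exec_inc|].
      eapply exec_seq; [apply exec_loop_24|apply exec_loop_42].
    + rewrite !Nat.add_0_r, tri_S.
      replace (d + (S c + tri c)) with ((c + S d) + tri c) by lia. apply IH.
Qed.

Lemma exec_loop_123 a b c d e f g :
  exec (CLoop 1 (CSeq (CInc 2) (CInc 3))) (regs7 a b c d e f g)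
    (regs7 a 0 (b + c) (b + d) e f g).
Proof.
  revert c d; induction b as [|b IH]; intros c d; [exec_end|].
  next.
  - eapply exec_seq with (regs7 a b (S c) d e f g); [exec_inc|].
    instantiate (1 := regs7 a b (S c) (S d) e f g). exec_inc.
  - replace (S b + d) with (b + S d) by lia.
    replace (S b + c) with (b + S c) by lia. apply IH.
Qed.

Lemma exec_loop_31 a b c d e f g :
  exec (CLoop 3 (CInc 1)) (regs7 a b c d e f g) (regs7 a (d + b) c 0 e f g).
Proof.
  revert b; induction d as [|d IH]; intros b; [exec_end|].
  next.
  - instantiate (1 := regs7 a (S b) c d e f g). exec_inc.
  - replace (S d + b) with (d + S b) by lia. apply IH.
Qed.

(** Turns [b] in register 1 into [tri (k + b) + b]: register 2 holds the argument of [tri], register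
    3 the summand [b]. *)
Definition pair_cmd (k : nat) : cmd :=
  CSeq (CLoop 1 (CSeq (CInc 2) (CInc 3)))
  (CSeq (incs 2 k) (CSeq tri_cmd (CLoop 3 (CInc 1)))).

Lemma exec_pair k a b f g :
  exec (pair_cmd k) (regs7 a b 0 0 0 f g) (regs7 a (cpair k b) 0 0 0 f g).
Proof.
  eapply exec_seq; [apply exec_loop_123|].
  eapply exec_seq; [apply exec_incs_2|].
  eapply exec_seq; [apply exec_tri|].
  rewrite !Nat.add_0_r.
  replace (cpair k b) with (b + tri (k + b) + 0) by (rewrite cpair_tri; lia).
  apply exec_loop_31.
Qed.

(** Puts an element of code [k] in front of a list coded by [enc_list]. *)
Definition cons_cmd (k : nat) : cmd := CSeq (pair_cmd k) (CInc 1).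

Lemma exec_cons k a b f g :
  exec (cons_cmd k) (regs7 a b 0 0 0 f g) (regs7 a (S (cpair k b)) 0 0 0 f g).
Proof. eapply exec_seq; [apply exec_pair|exec_inc]. Qed.

Lemma exec_repeat k a b f g :
  exec (CLoop 5 (cons_cmd k)) (regs7 a b 0 0 0 f g)
    (regs7 a (Nat.iter f (fun x => S (cpair k x)) b) 0 0 0 0 g).
Proof.
  revert b; induction f as [|f IH]; intros b; [exec_end|].
  next; [apply exec_cons|]. rewrite Nat.iter_succ_r. apply IH.
Qed.

Lemma exec_loop_0 a b c d e f g :
  exec (CLoop 0 (CSeq (CInc 5) (CInc 6))) (regs7 a b c d e f g)
    (regs7 0 b c d e (a + f) (a + g)).
Proof.
  revert f g; induction a as [|a IH]; intros f g; [exec_end|].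
  next.
  - eapply exec_seq with (regs7 a b c d e (S f) g); [exec_inc|].
    instantiate (1 := regs7 a b c d e (S f) (S g)). exec_inc.
  - replace (S a + f) with (a + S f) by lia.
    replace (S a + g) with (a + S g) by lia. apply IH.
Qed.

Lemma exec_loop_12 a b c d e f g :
  exec (CLoop 1 (CInc 2)) (regs7 a b c d e f g) (regs7 a 0 (b + c) d e f g).
Proof.
  revert c; induction b as [|b IH]; intros c; [exec_end|].
  next.
  - instantiate (1 := regs7 a b (S c) d e f g). exec_inc.
  - replace (S b + c) with (b + S c) by lia. apply IH.
Qed.

Lemma exec_loop_623 a b c d e f g :
  exec (CLoop 6 (CSeq (CInc 2) (CInc 3))) (regs7 a b c d e f g)
    (regs7 a b (g + c) (g + d) e f 0).
Proof.
  revert c d; induction g as [|g IH]; intros c d; [exec_end|].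
  next.
  - eapply exec_seq with (regs7 a b (S c) d e f g); [exec_inc|].
    instantiate (1 := regs7 a b (S c) (S d) e f g). exec_inc.
  - replace (S g + d) with (g + S d) by lia.
    replace (S g + c) with (g + S c) by lia. apply IH.
Qed.

Lemma exec_loop_30 a b c d e f g :
  exec (CLoop 3 (CInc 0)) (regs7 a b c d e f g) (regs7 (d + a) b c 0 e f g).
Proof.
  revert a; induction d as [|d IH]; intros a; [exec_end|].
  next.
  - instantiate (1 := regs7 (S a) b c d e f g). exec_inc.
  - replace (S d + a) with (d + S a) by lia. apply IH.
Qed.

(** The input is copied to register 5, which counts letters, and to register 6, the succedent code.
    The antecedent is built from its last element to the front, [pair_cmd 0] adds the empty stoup,
    and the rest pairs the result with register 6. *)
Definition code_cmd (kb kq ka ke : nat) : cmd :=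
  CSeq (CLoop 0 (CSeq (CInc 5) (CInc 6)))
  (CSeq (cons_cmd ke) (CSeq (CLoop 5 (cons_cmd ka))
  (CSeq (cons_cmd kq) (CSeq (cons_cmd kb) (CSeq (pair_cmd 0)
  (CSeq (CLoop 1 (CInc 2)) (CSeq (CLoop 6 (CSeq (CInc 2) (CInc 3)))
  (CSeq tri_cmd (CLoop 3 (CInc 0)))))))))).

(** The two uses of [n], as number of letters and as code of the succedent, are the diagonal. *)
Definition code_fun (kb kq ka ke n : nat) : nat :=
  let l k x := S (cpair k x) in
  cpair (cpair 0 (l kb (l kq (Nat.iter n (l ka) (l ke 0))))) n.

Lemma exec_code kb kq ka ke n :
  exec (code_cmd kb kq ka ke) (regs7 n 0 0 0 0 0 0)
    (regs7 (code_fun kb kq ka ke n) 0 0 0 0 0 0).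
Proof.
  eapply exec_seq; [apply exec_loop_0|].
  eapply exec_seq; [apply exec_cons|].
  eapply exec_seq; [apply exec_repeat|].
  eapply exec_seq; [apply exec_cons|].
  eapply exec_seq; [apply exec_cons|].
  eapply exec_seq; [apply exec_pair|].
  eapply exec_seq; [apply exec_loop_12|].
  eapply exec_seq; [apply exec_loop_623|].
  eapply exec_seq; [apply exec_tri|].
  rewrite !Nat.add_0_r. unfold code_fun.
  set (x := cpair 0 _).
  replace (cpair x n) with (n + tri (n + x) + 0).
  - apply exec_loop_30.
  - rewrite cpair_tri, (Nat.add_comm x n). lia.
Qed.

Lemma avoids_incs j r k : r <> j -> avoids j (incs r k).
Proof. intros H; induction k; simpl; auto. Qed.

Lemma avoids_code kb kq ka ke : avoids 7 (code_cmd kb kq ka ke).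
Proof.
  simpl. repeat split; first [lia | apply avoids_incs; lia].
Qed.

(** * The diagonal machine *)

(** Clamping sends every halting jump to the first address behind the copy, where execution goes
    on. *)
Definition relocate (p : program) (o : nat) : program :=
  map (fun i => match i with Inc r => Inc r | Dec r j => Dec r (o + clamp p j) end) p.

Lemma relocate_length p o : length (relocate p o) = length p.
Proof. apply length_map. Qed.

Lemma relocate_run p l m k c :
  reaches (l ++ relocate p (length l) ++ m)
    (length l + clamp p (fst c), snd c)
    (length l + clamp p (fst (run p k c)), snd (run p k c)).
Proof.
  revert c; induction k as [|k IH]; intros [pc s]; [apply reaches_refl|].
  change (run p (S k) (pc, s)) with (run p k (step p (pc, s))).
  destruct (Nat.le_gt_cases (length p) pc) as [H|H].
  (* A halted [p] stands still, and the copy makes no step into [m]; hence [reaches] instead of a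
     fixed number of steps. *)
  { rewrite step_halted by exact H. apply IH. }
  eapply reaches_trans; [|apply IH].
  match goal with |- reaches ?P ?a ?b => replace b with (step P a); [apply reaches_step|] end.
  assert (Hc : forall j, j <= length p -> clamp p j = j) by (intros; apply Nat.min_l; auto).
  simpl fst; simpl snd. rewrite (Hc pc) by lia.
  simpl. rewrite nth_error_app2, Nat.add_comm, Nat.add_sub by lia.
  rewrite nth_error_app1 by (rewrite relocate_length; lia).
  unfold relocate. rewrite nth_error_map.
  destruct (nth_error p pc) as [[r|r j]|] eqn:E; simpl.
  - rewrite Hc by lia. f_equal; lia.
  - destruct (s r); simpl; [reflexivity|]. rewrite Hc by lia. f_equal; lia.
  - apply nth_error_None in E. lia.
Qed.

(* The last two instructions halt on output 0 and loop on output 1. *)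
Definition diag (kb kq ka ke : nat) (p : program) : program :=
  let l := compile 7 0 (code_cmd kb kq ka ke) in
  let e := length l + length p in
  l ++ relocate p (length l) ++ [Dec 0 (e + 2); Dec 0 (e + 1)].

Lemma init_regs7 n : snd (init n) = regs7 n 0 0 0 0 0 0.
Proof. simpl. regs_eq. Qed.

Lemma reaches_halts p c c' : reaches p c c' -> halts p c <-> halts p c'.
Proof. intros [k <-]. apply halts_run. Qed.

Lemma diag_halts kb kq ka ke p n b :
  decides_at p (code_fun kb kq ka ke n) b ->
  (b -> ~ halts (diag kb kq ka ke p) (init n)) /\
  (~ b -> halts (diag kb kq ka ke p) (init n)).
Proof.
  intros (k & Hh & H1 & H0). simpl in Hh, H1, H0.
  set (N := code_fun kb kq ka ke n) in *.
  set (l := compile 7 0 (code_cmd kb kq ka ke)).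
  set (e := length l + length p).
  set (c := run p k (init N)) in *.
  assert (R : reaches (diag kb kq ka ke p) (init n) (e, snd c)).
  { apply reaches_trans with (length l, snd (init N)).
    - change (init n) with (0, snd (init n)).
      rewrite !init_regs7. unfold l at 1. rewrite compile_length.
      apply (exec_reaches 7 _ _ _ (exec_code kb kq ka ke n) (avoids_code kb kq ka ke)
        eq_refl (diag kb kq ka ke p) [] _ eq_refl).
    - pose proof (relocate_run p l [Dec 0 (e + 2); Dec 0 (e + 1)] k (init N)) as R.
      fold c in R.
      replace (clamp p (fst c)) with (length p) in R
        by (unfold clamp; rewrite Nat.min_r; auto).
      simpl fst in R. rewrite Nat.add_0_r in R. exact R. }
  assert (L : length (diag kb kq ka ke p) = e + 2).
  { unfold diag. fold l. rewrite !length_app, relocate_length. unfold e. simpl. lia. }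
  assert (E0 : nth_error (diag kb kq ka ke p) e = Some (Dec 0 (e + 2))).
  { unfold diag. fold l e.
    rewrite app_assoc.
    replace e with (length (l ++ relocate p (length l))) at 3
      by (rewrite length_app, relocate_length; reflexivity).
    apply nth_error_mid. }
  assert (E1 : nth_error (diag kb kq ka ke p) (S e) = Some (Dec 0 (e + 1))).
  { unfold diag. fold l e.
    rewrite app_assoc.
    change [Dec 0 (e + 2); Dec 0 (e + 1)] with ([Dec 0 (e + 2)] ++ [Dec 0 (e + 1)]).
    rewrite app_assoc.
    replace (S e) with (length ((l ++ relocate p (length l)) ++ [Dec 0 (e + 2)]))
      by (rewrite !length_app, relocate_length; unfold e; simpl; lia).
    apply nth_error_mid. }
  generalize dependent (diag kb kq ka ke p). intros D R L E0 E1.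
  clearbody e.
  split; intros Hb; rewrite (reaches_halts _ _ _ R), halts_step; unfold step; rewrite E0.
  (* On output 1 the decrement at [e] leaves zero, so the instruction at [S e] jumps to itself
     forever. *)
  - rewrite (H1 Hb). intros [i Hi]. revert Hi.
    set (s := upd (snd c) 0 0).
    enough (F : run D i (S e, s) = (S e, s)).
    { rewrite F. unfold halted. rewrite L. simpl. lia. }
    induction i as [|i IH]; cbn [run]; auto.
    replace (step D (S e, s)) with (S e, s); [exact IH|].
    unfold step. rewrite E1. replace (s 0) with 0 by reflexivity.
    now rewrite Nat.add_1_r.
  - rewrite (H0 Hb). exists 0. unfold halted. rewrite L. simpl. lia.
Qed.

(** * A word model *)

Section Model.
Context {X : Type} (Acc : list X -> Prop) (val : nat -> list X -> Prop).

(** The double polar of [P] in the Galois connection between words [w] and contexts [(x, y)] given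
    by [Acc (x ++ w ++ y)]. *)
Definition closure (P : list X -> Prop) (w : list X) : Prop :=
  forall x y, (forall u, P u -> Acc (x ++ u ++ y)) -> Acc (x ++ w ++ y).

Definition closed (P : list X -> Prop) : Prop := forall w, closure P w -> P w.

Lemma closure_in (P : list X -> Prop) w : P w -> closure P w.
Proof. intros H x y K. auto. Qed.

Lemma closure_closed P : closed (closure P).
Proof. intros w H x y K. apply H. intros u Hu. now apply Hu. Qed.

(** A context accepting [P], composed with [(x, y)], accepts [Q] and hence [w]. This lets a left
    rule replace an element of a closure by a generator. *)
Lemma closed_elim P Q x w y :
  closed P -> closure Q w -> (forall u, Q u -> P (x ++ u ++ y)) -> P (x ++ w ++ y).
Proof.
  intros HP Hw H. apply HP. intros x' y' K.
  specialize (Hw (x' ++ x) (y ++ y')).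
  rewrite <- !app_assoc in *. apply Hw.
  intros u Hu. specialize (K _ (H u Hu)). now rewrite <- !app_assoc in *.
Qed.

(* The brackets and both of their modalities are read as the identity. *)
Fixpoint den (A : formula) : list X -> Prop :=
  match A with
  | FVar n => closure (val n)
  | FOne => closure (eq [])
  | FUnder A C => fun w => forall u, den A u -> den C (u ++ w)
  | FOver C B => fun w => forall u, den B u -> den C (w ++ u)
  | FProd A B => closure (fun w => exists u v, w = u ++ v /\ den A u /\ den B v)
  | FAnd _ _ | FOr _ _ => fun _ => True
  | FDia A | FBoxI A => den A
  | FBang A => closure (fun w => w = [] /\ den A [])
  end.

(** Residuals of closed sets are closed by [closed_elim]. *)
Lemma den_closed A : closed (den A).
Proof.
  induction A; simpl; try exact (closure_closed _); auto.
  - intros w H u Hu. rewrite <- (app_nil_r (u ++ w)), <- app_assoc.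
    apply (closed_elim _ _ _ _ _ IHA2 H). intros v Hv. rewrite app_nil_r. auto.
  - intros w H u Hu. apply (closed_elim _ _ [] w u IHA1 H). simpl. auto.
  - intros w _. exact I.
  - intros w _. exact I.
Qed.

Fixpoint yield (t : tterm) : list formula :=
  match t with TFor A => [A] | TBr _ G => flat_map yield G end.

Fixpoint stoups (t : tterm) : list formula :=
  match t with TFor _ => [] | TBr z G => z ++ flat_map stoups G end.

Fixpoint den_list (l : list formula) (w : list X) : Prop :=
  match l with
  | [] => w = []
  | A :: l => exists u v, w = u ++ v /\ den A u /\ den_list l v
  end.

Definition valid (A : formula) : Prop := den A [].

(** Stoup formulae contribute no letters, only the condition of being valid, so they may be copied
    and moved between brackets. *)
Definition den_meta (m : meta) (w : list X) : Prop :=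
  Forall valid (fst m ++ flat_map stoups (snd m)) /\
  den_list (flat_map yield (snd m)) w.

Lemma den_list_app l l' w :
  den_list (l ++ l') w <-> exists u v, w = u ++ v /\ den_list l u /\ den_list l' v.
Proof.
  revert w; induction l as [|A l IH]; intros w; simpl.
  - split; [intros H; now exists [], w|]. now intros (u & v & -> & -> & H).
  - split.
    + intros (u & v & -> & HA & H). apply IH in H. destruct H as (u' & v' & -> & H & H').
      exists (u ++ u'), v'. split; [apply app_assoc|]. split; [|exact H'].
      now exists u, u'.
    + intros (u & v & -> & (u1 & u2 & -> & HA & H) & H').
      exists u1, (u2 ++ v). rewrite app_assoc. split; auto. split; auto.
      apply IH. now exists u2, v.
Qed.

Lemma den_list_1 A w : den_list [A] w <-> den A w.
Proof.
  simpl. split.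
  - intros (u & v & -> & H & ->). now rewrite app_nil_r.
  - intros H. exists w, []. now rewrite app_nil_r.
Qed.

(** With brackets erased, the content of the hole is a factor of the word and all stoups form one
    list, so the factor can be exchanged. *)
Lemma den_meta_fill c m w :
  den_meta (fill c m) w -> exists x u y, w = x ++ u ++ y /\ den_meta m u /\
  forall m' u', den_meta m' u' -> den_meta (fill c m') (x ++ u' ++ y).
Proof.
  revert w; induction c as [|z G1 c IH G2]; intros w; simpl.
  - intros H. exists [], w, []. simpl. rewrite app_nil_r. split; auto. split; auto.
    intros m' u'. now rewrite app_nil_r.
  - unfold den_meta at 1. simpl. rewrite !flat_map_app. simpl. intros [Hz Hw].
    apply den_list_app in Hw. destruct Hw as (w1 & w2 & -> & H1 & Hw).
    apply den_list_app in Hw. destruct Hw as (w3 & w4 & -> & H3 & H4).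
    rewrite !Forall_app in Hz. destruct Hz as (Hz & HG1 & (Hc & Hc') & HG2).
    destruct (IH w3) as (x & u & y & -> & Hu & Hc'').
    { split; auto. rewrite Forall_app. auto. }
    exists (w1 ++ x), u, (y ++ w4). split; [now rewrite <- !app_assoc|]. split; auto.
    intros m' u' Hu'. specialize (Hc'' m' u' Hu'). destruct Hc'' as [Hs Hy].
    split; simpl; rewrite !flat_map_app; simpl.
    + rewrite !Forall_app. rewrite Forall_app in Hs. tauto.
    + replace ((w1 ++ x) ++ u' ++ y ++ w4) with (w1 ++ (x ++ u' ++ y) ++ w4)
        by now rewrite <- !app_assoc.
      apply den_list_app. eexists _, _. split; [reflexivity|]. split; auto.
      apply den_list_app. eexists _, _. split; [reflexivity|]. split; auto.
Qed.

(** The inner [fix] reaches the subterms that [teq] nests under [Forall2]. *)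
Fixpoint teq_yield t t' (H : teq t t') {struct H} : yield t = yield t'.
Proof.
  destruct H as [A|z z' G G' Hz HG]; simpl; [reflexivity|].
  revert G G' HG. fix IH 3. intros G G' HG.
  destruct HG as [|x y G G' Hx HG]; simpl; [reflexivity|].
  f_equal; [now apply teq_yield|now apply IH].
Qed.

Fixpoint teq_stoups t t' (H : teq t t') {struct H} : Permutation (stoups t) (stoups t').
Proof.
  destruct H as [A|z z' G G' Hz HG]; simpl; [reflexivity|].
  apply Permutation_app; [exact Hz|].
  revert G G' HG. fix IH 3. intros G G' HG.
  destruct HG as [|x y G G' Hx HG]; simpl; [reflexivity|].
  apply Permutation_app; [now apply teq_stoups|now apply IH].
Qed.

Lemma den_meta_meq m m' w : meq m m' -> den_meta m' w -> den_meta m w.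
Proof.
  destruct m as [z G], m' as [z' G']. intros [Hz HG]. simpl in *.
  unfold den_meta; simpl. intros [Hv Hw]. split.
  - eapply Permutation_Forall; [|exact Hv]. symmetry.
    apply Permutation_app; [exact Hz|].
    clear - HG. induction HG; simpl; auto. apply Permutation_app; auto.
    now apply teq_stoups.
  - replace (flat_map yield G) with (flat_map yield G'); auto.
    clear - HG. induction HG; simpl; auto. f_equal; auto. symmetry. now apply teq_yield.
Qed.

Ltac split_den :=
  repeat match goal with
  | H : den_meta (_, _) _ |- _ =>
      destruct H as [? ?]; simpl in *
  | H : context [flat_map _ (_ ++ _)] |- _ => rewrite flat_map_app in H; simpl in H
  | H : Forall _ (_ ++ _) |- _ => apply Forall_app in H; destruct H
  | H : Forall _ (_ :: _) |- _ => inversion H; clear H; subst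
  | H : den_list (_ ++ _) _ |- _ =>
      apply den_list_app in H; destruct H as (? & ? & -> & ? & ?)
  | H : den_list [] _ |- _ => simpl in H; subst
  | H : den_list (_ :: _) _ |- _ => destruct H as (? & ? & -> & ? & ?)
  | H : exists _, _ |- _ => destruct H
  | H : _ /\ _ |- _ => destruct H
  end.

Ltac solve_forall :=
  repeat match goal with
  | |- Forall _ (_ ++ _) => apply Forall_app; split
  | |- Forall _ (_ :: _) => constructor
  | |- Forall _ [] => constructor
  end; auto.

Lemma den_list_app_i l l' u v :
  den_list l u -> den_list l' v -> den_list (l ++ l') (u ++ v).
Proof. intros H H'. apply den_list_app. now exists u, v. Qed.

Lemma den_list_cons_i A l u v :
  den A u -> den_list l v -> den_list (A :: l) (u ++ v).
Proof. intros H H'. now exists u, v. Qed.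

(** The modal rules become trivial, contraction repeats a validity condition, and the right rules
    for [!] concern the empty word only. *)
Theorem deriv_sound s q :
  deriv s q -> forall w, den_meta (fst q) w -> den (snd q) w.
Proof.
  induction 1; simpl in *; intros w Hw;
    try (apply den_meta_fill in Hw; destruct Hw as (x & u & y & -> & Hu & K)).
  - destruct Hw as [_ Hw]. now apply den_list_1.
  - destruct Hw as [_ ->]. now apply closure_in.
  - split_den.
    apply IHderiv2, K. split; simpl; rewrite ?flat_map_app; simpl.
    + solve_forall.
    + apply den_list_app_i; auto. rewrite app_assoc. apply den_list_cons_i; auto.
      match goal with H : den (FOver _ _) _ |- _ => apply H | H : den (FUnder _ _) _ |- _ => apply H end.
      apply IHderiv1. split; simpl; auto. solve_forall.
  - intros u Hu. apply IHderiv. split_den. split; simpl; rewrite ?flat_map_app; simpl.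
    + solve_forall.
    + apply den_list_app_i; auto. now apply den_list_1.
  - split_den.
    apply IHderiv2, K. split; simpl; rewrite ?flat_map_app; simpl.
    + solve_forall.
    + apply den_list_app_i; auto. rewrite app_assoc. apply den_list_cons_i; auto.
      match goal with H : den (FOver _ _) _ |- _ => apply H | H : den (FUnder _ _) _ |- _ => apply H end.
      apply IHderiv1. split; simpl; auto. solve_forall.
  - intros u Hu. apply IHderiv. split_den. split; simpl.
    + solve_forall.
    + apply den_list_cons_i; auto.
  (* The concatenations only generate the product; as the succedent is closed, checking them
     suffices. *)
  - split_den. rewrite <- !app_assoc, app_assoc.
    eapply closed_elim; [apply den_closed|eassumption|].
    intros u (a & b & -> & Ha & Hb). rewrite <- !app_assoc.
    rewrite (app_assoc b), (app_assoc a), (app_assoc x0).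
    apply IHderiv, K. split; simpl; rewrite ?flat_map_app; simpl.
    + solve_forall.
    + rewrite <- ?app_assoc. repeat (apply den_list_app_i || apply den_list_cons_i); auto.
  - split_den. apply closure_in. eexists _, _. split; [reflexivity|]. split.
    + apply IHderiv1. split; simpl; auto. solve_forall.
    + apply IHderiv2. split; simpl; auto. solve_forall.
  - split_den. rewrite <- !app_assoc, app_assoc.
    eapply closed_elim; [apply den_closed|eassumption|].
    intros u <-. simpl. rewrite <- app_assoc, (app_assoc x0).
    apply IHderiv, K. split; simpl; rewrite ?flat_map_app; simpl.
    + solve_forall.
    + now apply den_list_app_i.
  - split_den. simpl. rewrite ?app_nil_r in *. apply IHderiv, K.
    split; simpl; rewrite ?flat_map_app; simpl.
    + solve_forall.
    + apply den_list_app_i; auto. apply den_list_cons_i; auto.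
  - apply IHderiv. destruct m. split_den. split; simpl; rewrite ?app_nil_r; auto.
    solve_forall.
  - split_den. apply IHderiv, K. split; simpl; rewrite ?flat_map_app; simpl.
    + solve_forall.
    + apply den_list_app_i; auto. apply den_list_cons_i; auto.
  - apply IHderiv. destruct m. split_den. rewrite ?app_nil_r in *.
    split; simpl; auto. solve_forall.
  (* The word for [!A] is replaced by the generator [[]], which comes with the validity of [A]
     demanded by the stoup. *)
  - split_den. rewrite <- !app_assoc, app_assoc.
    eapply closed_elim; [apply den_closed|eassumption|].
    intros u [-> HA]. simpl. rewrite <- app_assoc, (app_assoc x0).
    apply IHderiv, K. split; simpl; rewrite ?flat_map_app; simpl.
    + solve_forall.
    + now apply den_list_app_i.
  - split_den. apply IHderiv, K. split; simpl; rewrite ?flat_map_app; simpl.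
    + solve_forall.
    + apply den_list_app_i; auto.
      (* A valid formula leaves the stoup as the empty word. *)
      match goal with |- den_list _ ?v => change v with ([] ++ v) end.
      now apply den_list_cons_i.
  - destruct Hw as [Hz ->]. apply closure_in. split; auto. apply IHderiv. now split.
  - destruct Hw as [Hz ->]. apply closure_in. split; auto. apply IHderiv. now split.
  - split_den. apply IHderiv, K. split; simpl; rewrite ?flat_map_app; simpl.
    + solve_forall.
    + repeat apply den_list_app_i; auto.
  - split_den. apply IHderiv, K. rewrite ?app_nil_r in *.
    split; simpl; rewrite ?flat_map_app; simpl.
    + solve_forall.
    + repeat apply den_list_app_i; auto.
  - apply IHderiv. eapply den_meta_meq; eauto.
Qed.
End Model.

(** * Counter machines as word rewriting *)

(* A configuration is a word [SLeft x q y SRight], where the letters [SLetter r] in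
   [x] and [y] count register [r]. The state [SState i] moves freely through the
   letters; [STest i] only passes letters of registers other than the tested one. *)
Inductive sym : Type :=
| SLeft
| SRight
| SHalt
| SLetter (r : nat)
| SState (i : nat)
| STest (i : nat).

Definition is_state (a : sym) : bool :=
  match a with SHalt | SState _ | STest _ => true | _ => false end.

Record rule : Type := Rule { lhs_l : list sym; lhs_q : sym; lhs_r : list sym; rhs : list sym }.

Definition reg_of (c : instr) : nat := match c with Inc r | Dec r _ => r end.

Definition nregs (p : program) : nat := S (list_max (map reg_of p)).

(** [SHalt] absorbs the whole word. Letters are taken from the right only, since the state can move
    to the left marker beforehand. *)
Definition halt_rules (p : program) : list rule :=
  Rule [] (SState (length p)) [] [SHalt] ::
  Rule [SLeft] SHalt [] [SHalt] ::
  Rule [] SHalt [SRight] [SHalt] ::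
  map (fun r => Rule [] SHalt [SLetter r] [SHalt]) (seq 0 (nregs p)).

Definition move_rules (p : program) (i : nat) : list rule :=
  flat_map (fun r => [Rule [] (SState i) [SLetter r] [SLetter r; SState i];
                      Rule [SLetter r] (SState i) [] [SState i; SLetter r]])
    (seq 0 (nregs p)).

(** A zero test starts at the left marker and succeeds only by reaching the right one without
    meeting a letter of the tested register. *)
Definition instr_rules (p : program) (i : nat) : list rule :=
  match nth_error p i with
  | None => []
  | Some (Inc r) => [Rule [] (SState i) [] [SState (S i); SLetter r]]
  | Some (Dec r j) =>
      Rule [] (SState i) [SLetter r] [SState (S i)] ::
      Rule [SLeft] (SState i) [] [SLeft; STest i] ::
      Rule [] (STest i) [SRight] [SState (clamp p j); SRight] ::
      map (fun t => Rule [] (STest i) [SLetter t] [SLetter t; STest i])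
        (filter (fun t => negb (Nat.eqb t r)) (seq 0 (nregs p)))
  end.

(** The index [length p] is included so that the halting state can move as well. *)
Definition rules (p : program) : list rule :=
  halt_rules p ++ flat_map (fun i => move_rules p i ++ instr_rules p i) (seq 0 (S (length p))).

(** * Acceptance of configuration words *)

Definition counts (w : list nat) : nat -> nat := count_occ Nat.eq_dec w.

Definition config_word (x : list nat) (q : sym) (y : list nat) : list sym :=
  SLeft :: map SLetter x ++ q :: map SLetter y ++ [SRight].

(** Letters to the left of [STest i] count as tested; if the tested register occurs there, the test
    is spurious and nothing is claimed. *)
Definition good (p : program) (x : list nat) (q : sym) (y : list nat) : Prop :=
  match q with
  | SState i => halts p (i, counts (x ++ y))
  | STest i =>
      match nth_error p i with
      | Some (Dec r _) => ~ In r x -> halts p (i, counts (x ++ y))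
      | _ => True
      end
  | _ => True
  end.

(** Words that are no configurations are accepted vacuously, so backward closure under a rule needs
    checking on configurations only. *)
Definition accepted (p : program) (w : list sym) : Prop :=
  forall x q y, is_state q = true -> w = config_word x q y -> good p x q y.

Definition no_state (w : list sym) : Prop := Forall (fun a => is_state a = false) w.

Lemma state_unique x q y x' q' y' :
  x ++ q :: y = x' ++ q' :: y' -> is_state q = true -> is_state q' = true ->
  no_state x' -> no_state y' -> x = x' /\ q = q' /\ y = y'.
Proof.
  intros E Hq Hq' Hx Hy. revert x E; induction Hx as [|a x' Ha Hx IH]; intros [|b x] E;
    simpl in E; injection E as E1 E2; subst; auto.
  - exfalso. unfold no_state in Hy. rewrite Forall_app in Hy.
    destruct Hy as [_ Hy]. inversion Hy; congruence.
  - congruence.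
  - destruct (IH x E2) as (-> & -> & ->). auto.
Qed.

Lemma no_state_letters w : no_state (map SLetter w).
Proof. apply Forall_map, Forall_forall. reflexivity. Qed.

Lemma config_word_unique X q Y x q' y :
  X ++ q :: Y = config_word x q' y -> is_state q = true -> is_state q' = true ->
  X = SLeft :: map SLetter x /\ q = q' /\ Y = map SLetter y ++ [SRight].
Proof.
  intros E Hq Hq'.
  apply (state_unique _ _ _ (SLeft :: map SLetter x) q' (map SLetter y ++ [SRight])) in E; auto.
  - constructor; [reflexivity|apply no_state_letters].
  - apply Forall_app; split; [apply no_state_letters|now repeat constructor].
Qed.

Lemma accepted_halt p X Y : accepted p (X ++ SHalt :: Y).
Proof.
  intros x q y Hq E. apply config_word_unique in E; auto.
  destruct E as (_ & <- & _). exact I.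
Qed.

Lemma counts_cons x r y : counts (x ++ r :: y) = upd (counts (x ++ y)) r (S (counts (x ++ y) r)).
Proof.
  extensionality t. unfold counts, upd. rewrite !count_occ_app. simpl.
  destruct (Nat.eqb_spec t r), (Nat.eq_dec r t); subst; try congruence; lia.
Qed.

Lemma counts_zero w r : ~ In r w <-> counts w r = 0.
Proof. apply count_occ_not_In. Qed.

Lemma upd_upd s r a b : upd (upd s r a) r b = upd s r b.
Proof. extensionality t. unfold upd. now destruct (Nat.eqb t r). Qed.

Lemma upd_id s r : upd s r (s r) = s.
Proof. extensionality t. unfold upd. now destruct (Nat.eqb_spec t r); subst. Qed.

Lemma step_inc p i r w : nth_error p i = Some (Inc r) ->
  step p (i, counts w) = (S i, counts (r :: w)).
Proof. intros E. unfold step. rewrite E. f_equal. symmetry. exact (counts_cons [] r w). Qed.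

Lemma step_dec p i r j x y : nth_error p i = Some (Dec r j) ->
  step p (i, counts (x ++ r :: y)) = (S i, counts (x ++ y)).
Proof.
  intros E. unfold step. rewrite E, counts_cons, upd_same.
  now rewrite upd_upd, upd_id.
Qed.

Lemma step_zero p i r j w : nth_error p i = Some (Dec r j) -> ~ In r w ->
  step p (i, counts w) = (j, counts w).
Proof. intros E H. unfold step. now rewrite E, (proj1 (counts_zero w r) H). Qed.

Lemma counts_perm x y : Permutation x y -> counts x = counts y.
Proof.
  intros H. extensionality t. apply (proj1 (Permutation_count_occ Nat.eq_dec x y) H).
Qed.

(* Backward closure of acceptance under one rule, on the words where it matters. *)
Definition sound_rule (p : program) (u : rule) : Prop :=
  forall x y X Y,
    X ++ lhs_l u = SLeft :: map SLetter x -> lhs_r u ++ Y = map SLetter y ++ [SRight] ->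
    accepted p (X ++ rhs u ++ Y) -> good p x (lhs_q u) y.

Lemma accepted_config p x q y w :
  accepted p w -> w = config_word x q y -> is_state q = true -> good p x q y.
Proof. intros H E Hq. now apply H. Qed.

Lemma left_letter_inv X r x : X ++ [SLetter r] = SLeft :: map SLetter x ->
  exists x', x = x' ++ [r] /\ X = SLeft :: map SLetter x'.
Proof.
  destruct x as [|t x _] using rev_ind; intros E.
  - apply (app_inj_tail X []) in E. destruct E; discriminate.
  - rewrite map_app, app_comm_cons in E. apply app_inj_tail in E.
    destruct E as [E1 E2]. injection E2 as <-. now exists x.
Qed.

Lemma left_end_inv X x : X ++ [SLeft] = SLeft :: map SLetter x -> x = [] /\ X = [].
Proof.
  destruct x as [|t x _] using rev_ind; intros E.
  - apply (app_inj_tail X []) in E. tauto.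
  - rewrite map_app, app_comm_cons in E. apply app_inj_tail in E.
    destruct E; discriminate.
Qed.

Lemma right_letter_inv Y r y : [SLetter r] ++ Y = map SLetter y ++ [SRight] ->
  exists y', y = r :: y' /\ Y = map SLetter y' ++ [SRight].
Proof.
  destruct y as [|t y]; simpl; intros E; [discriminate|].
  injection E as <- ->. now exists y.
Qed.

Lemma right_end_inv Y y : [SRight] ++ Y = map SLetter y ++ [SRight] -> y = [] /\ Y = [].
Proof.
  destruct y as [|t y]; simpl; intros E; [|discriminate].
  injection E as ->. auto.
Qed.

Ltac config_eq :=
  unfold config_word; simpl; rewrite ?map_app; simpl; rewrite <- ?app_assoc; reflexivity.

(** Forgets the bounds on registers and states, which leaves one case analysis over the shapes of
    rules. *)
Inductive is_rule (p : program) : rule -> Prop :=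
| is_rule_halt : is_rule p (Rule [] (SState (length p)) [] [SHalt])
| is_rule_halt_l a : is_rule p (Rule [a] SHalt [] [SHalt])
| is_rule_halt_r a : is_rule p (Rule [] SHalt [a] [SHalt])
| is_rule_right i r : is_rule p (Rule [] (SState i) [SLetter r] [SLetter r; SState i])
| is_rule_left i r : is_rule p (Rule [SLetter r] (SState i) [] [SState i; SLetter r])
| is_rule_inc i r : nth_error p i = Some (Inc r) ->
    is_rule p (Rule [] (SState i) [] [SState (S i); SLetter r])
| is_rule_dec i r j : nth_error p i = Some (Dec r j) ->
    is_rule p (Rule [] (SState i) [SLetter r] [SState (S i)])
| is_rule_test i r j : nth_error p i = Some (Dec r j) ->
    is_rule p (Rule [SLeft] (SState i) [] [SLeft; STest i])
| is_rule_pass i r j t : nth_error p i = Some (Dec r j) -> t <> r ->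
    is_rule p (Rule [] (STest i) [SLetter t] [SLetter t; STest i])
| is_rule_zero i r j : nth_error p i = Some (Dec r j) ->
    is_rule p (Rule [] (STest i) [SRight] [SState (clamp p j); SRight]).

Lemma rules_is_rule p u : In u (rules p) -> is_rule p u.
Proof.
  intros Hu. apply in_app_or in Hu. destruct Hu as [Hu|Hu].
  - destruct Hu as [<-|[<-|[<-|Hu]]]; try constructor.
    apply in_map_iff in Hu. destruct Hu as (r & <- & _). constructor.
  - apply in_flat_map in Hu. destruct Hu as (i & _ & Hu).
    apply in_app_or in Hu. destruct Hu as [Hu|Hu].
    + apply in_flat_map in Hu. destruct Hu as (r & _ & [<-|[<-|[]]]); constructor.
    + unfold instr_rules in Hu. destruct (nth_error p i) as [[r|r j]|] eqn:E; [| |destruct Hu].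
      * destruct Hu as [<-|[]]. now constructor.
      * destruct Hu as [<-|[<-|[<-|Hu]]]; try (econstructor; eassumption).
        apply in_map_iff in Hu. destruct Hu as (t & <- & Ht).
        apply filter_In in Ht. destruct Ht as [_ Ht].
        econstructor; [eassumption|]. intros ->. rewrite Nat.eqb_refl in Ht. discriminate.
Qed.

(** Apart from the rules producing [SHalt], the rewritten word is again a configuration: moves keep
    the counts, instructions follow [step]. *)
Lemma rules_sound p u : In u (rules p) -> sound_rule p u.
Proof.
  intros Hu. apply rules_is_rule in Hu. destruct Hu as
    [|a|a|i r|i r|i r E|i r j E|i r j E|i r j t E Ht|i r j E];
    intros x y X Y EX EY HA; cbn [lhs_l lhs_q lhs_r rhs] in *; try exact I;
    rewrite ?app_nil_r in EX.
  - exists 0. unfold halted. simpl. lia.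
  - apply right_letter_inv in EY. destruct EY as (y' & -> & ->). subst X.
    eapply (accepted_config p (x ++ [r]) (SState i) y') in HA; [|config_eq|reflexivity].
    simpl in HA. now rewrite <- app_assoc in HA.
  - apply left_letter_inv in EX. destruct EX as (x' & -> & ->). simpl in EY. subst Y.
    eapply (accepted_config p x' (SState i) (r :: y)) in HA; [|config_eq|reflexivity].
    simpl in *. now rewrite <- app_assoc.
  - simpl in EY. subst X Y.
    eapply (accepted_config p x (SState (S i)) (r :: y)) in HA; [|config_eq|reflexivity].
    simpl in *. rewrite halts_step, (step_inc _ _ _ _ E).
    now rewrite (counts_perm _ _ (Permutation_middle x y r)).
  - apply right_letter_inv in EY. destruct EY as (y' & -> & ->). subst X.
    eapply (accepted_config p x (SState (S i)) y') in HA; [|config_eq|reflexivity].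
    simpl in *. now rewrite halts_step, (step_dec _ _ _ _ _ _ E).
  (* At the left marker no letter has been passed, so the proviso for [STest i] holds. *)
  - apply left_end_inv in EX. destruct EX as (-> & ->). simpl in EY. subst Y.
    eapply (accepted_config p [] (STest i) y) in HA; [|config_eq|reflexivity].
    simpl in HA. rewrite E in HA. apply HA. auto.
  - apply right_letter_inv in EY. destruct EY as (y' & -> & ->). subst X.
    eapply (accepted_config p (x ++ [t]) (STest i) y') in HA; [|config_eq|reflexivity].
    simpl in *. rewrite E in HA |- *. intros Hr. rewrite <- app_assoc in HA. apply HA.
    rewrite in_app_iff. simpl. intros [H|[H|[]]]; auto.
  (* At the right marker the entire word has been passed, so the register is zero and the machine
     jumps. *)
  - apply right_end_inv in EY. destruct EY as (-> & ->). subst X.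
    eapply (accepted_config p x (SState (clamp p j)) []) in HA; [|config_eq|reflexivity].
    simpl in *. rewrite E. intros Hr. rewrite halts_clamp in HA. rewrite app_nil_r in *.
    now rewrite halts_step, (step_zero _ _ _ _ _ E).
Qed.

Lemma rules_state p u : In u (rules p) -> is_state (lhs_q u) = true.
Proof. intros Hu. now destruct (rules_is_rule p u Hu). Qed.

Lemma rules_rhs p u : In u (rules p) -> rhs u <> [].
Proof. intros Hu. now destruct (rules_is_rule p u Hu). Qed.

Lemma accepted_rule p u X Y : In u (rules p) ->
  accepted p (X ++ rhs u ++ Y) -> accepted p (X ++ (lhs_l u ++ lhs_q u :: lhs_r u) ++ Y).
Proof.
  intros Hu HA x q y Hq E.
  assert (E' : (X ++ lhs_l u) ++ lhs_q u :: (lhs_r u ++ Y) = config_word x q y)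
    by (rewrite <- E, <- !app_assoc; reflexivity).
  apply config_word_unique in E'; [|exact (rules_state p u Hu)|exact Hq].
  destruct E' as (EX & <- & EY). exact (rules_sound p u Hu x y X Y EX EY HA).
Qed.

Lemma init_counts n : init n = (0, counts (repeat 0 n)).
Proof.
  unfold init. f_equal. extensionality r. unfold counts.
  destruct (Nat.eqb_spec r 0) as [->|Hr].
  - now rewrite count_occ_repeat_eq.
  - now rewrite count_occ_repeat_neq by auto.
Qed.

(** * Rules as formulae *)

(** The constants take 0 to 2, the indexed families one residue modulo 3 each above that. *)
Definition sym_code (a : sym) : nat :=
  match a with
  | SLeft => 0 | SRight => 1 | SHalt => 2
  | SLetter r => 3 + 3 * r | SState i => 4 + 3 * i | STest i => 5 + 3 * i
  end.

Lemma sym_code_inj a b : sym_code a = sym_code b -> a = b.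
Proof. destruct a, b; simpl; intros H; try reflexivity;
    first [exfalso; lia | f_equal; lia]. Qed.

(* In the 2018 systems a contraction consumes a double bracket, so a state brings one. *)
Definition sym_form (s : system) (a : sym) : formula :=
  let v := FVar (sym_code a) in
  if is_state a then match s with S2015 => v | _ => FDia (FDia v) end else v.

(** [FVar 0] is a filler for the empty product; the unit would leave the fragment of
    [S2018minus]. *)
Fixpoint prod_form (l : list formula) : formula :=
  match l with
  | [] => FVar 0
  | [A] => A
  | A :: l => FProd A (prod_form l)
  end.

(** The last element ends up outermost, being the one adjacent to the formula, so that [l] followed
    by [under_form l C] reduces to [C]. In [over_form] the first element is outermost for the same
    reason. *)
Fixpoint under_form (l : list formula) (C : formula) : formula :=
  match l with [] => C | A :: l => under_form l (FUnder A C) end.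

Fixpoint over_form (l : list formula) (C : formula) : formula :=
  match l with [] => C | A :: l => FOver (over_form l C) A end.

Definition rule_body (s : system) (u : rule) : formula :=
  under_form (map (sym_form s) (lhs_l u))
    (over_form (map (sym_form s) (lhs_r u)) (prod_form (map (sym_form s) (rhs u)))).

(** The state is a bare variable here, without the diamonds of [sym_form]: when the rule fires it
    already stands inside a bracket. *)
Definition rule_form (s : system) (u : rule) : formula :=
  FUnder (FVar (sym_code (lhs_q u))) (FBoxI (rule_body s u)).

Definition stoup (s : system) (p : program) : list formula := map (rule_form s) (rules p).

(* No weakening: the succedent absorbs one last copy of every rule. *)
Definition goal (s : system) (p : program) : formula :=
  prod_form (sym_form s SHalt :: stoup s p).

Definition machine_form (s : system) (p : program) : formula :=
  fold_right (fun R C => FUnder (FBang R) C) (goal s p) (stoup s p).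

Definition word_terms (s : system) (w : list sym) : list tterm :=
  map (fun a => TFor (sym_form s a)) w.

Definition machine_sequent (s : system) (p : program) (n : nat) : sequent :=
  (([], word_terms s (config_word [] (SState 0) (repeat 0 n))), machine_form s p).

(** * Derivable sequents describe halting computations *)

Section Soundness.
Variables (s : system) (p : program).

Let val (n : nat) (w : list sym) : Prop := exists a, sym_code a = n /\ w = [a].
Let Den := den (accepted p) val.
Let Cl := closure (accepted p).

Lemma den_sym_form a w : Den (sym_form s a) w <-> Cl (eq [a]) w.
Proof.
  assert (E : Den (sym_form s a) w <-> Cl (val (sym_code a)) w).
  { unfold sym_form. destruct (is_state a), s; reflexivity. }
  rewrite E. unfold Cl, closure.
  split; intros H x y K; apply H; intros u Hu.
  - destruct Hu as (b & Hb & ->). apply sym_code_inj in Hb. subst. now apply K.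
  - subst. apply K. now exists a.
Qed.

Lemma den_var a w : Den (FVar (sym_code a)) w <-> Cl (eq [a]) w.
Proof.
  unfold Den. simpl. unfold Cl, closure.
  split; intros H x y K; apply H; intros u Hu.
  - destruct Hu as (b & Hb & ->). apply sym_code_inj in Hb. subst. now apply K.
  - subst. apply K. now exists a.
Qed.

Lemma closure_app u v a b : Cl (eq u) a -> Cl (eq v) b -> Cl (eq (u ++ v)) (a ++ b).
Proof.
  intros Ha Hb x y K. rewrite <- app_assoc. apply Ha. intros ? <-.
  rewrite app_assoc. apply Hb. intros ? <-.
  specialize (K _ eq_refl). now rewrite <- !app_assoc in *.
Qed.

Lemma den_word w a : den_list (accepted p) val (map (sym_form s) w) a -> Cl (eq w) a.
Proof.
  revert a; induction w as [|c w IH]; simpl; intros a.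
  - intros ->. now apply closure_in.
  - intros (u & v & -> & Hu & Hv). apply (closure_app [c]); auto.
    now apply den_sym_form.
Qed.

Lemma den_word_self w : den_list (accepted p) val (map (sym_form s) w) w.
Proof.
  induction w as [|c w IH]; simpl; auto.
  exists [c], w. repeat split; auto. apply den_sym_form. now apply closure_in.
Qed.

Lemma den_prod l w : l <> [] -> den_list (accepted p) val l w -> Den (prod_form l) w.
Proof.
  revert w; induction l as [|A l IH]; intros w Hl; [congruence|].
  destruct l as [|B l]; [apply den_list_1|].
  intros (u & v & -> & Hu & Hv). apply closure_in. exists u, v.
  repeat split; auto. apply IH; auto; discriminate.
Qed.

Lemma den_under l C w :
  (forall a, den_list (accepted p) val l a -> Den C (a ++ w)) -> Den (under_form l C) w.
Proof.
  revert C w; induction l as [|A l IH]; intros C w H; simpl; [now apply (H [])|].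
  apply IH. intros v Hv u Hu. rewrite app_assoc. apply H. now exists u, v.
Qed.

Lemma den_over l C w :
  (forall b, den_list (accepted p) val l b -> Den C (w ++ b)) -> Den (over_form l C) w.
Proof.
  revert w; induction l as [|A l IH]; intros w H; simpl.
  - rewrite <- (app_nil_r w). now apply H.
  - intros u Hu. apply IH. intros v Hv. rewrite <- app_assoc. apply H. now exists u, v.
Qed.

(** Acceptance is closed backward under [u] in every context by [accepted_rule], so the left side of
    [u] lies in the closure of its right side. *)
Lemma rule_form_valid u : In u (rules p) -> valid (accepted p) val (rule_form s u).
Proof.
  intros Hu w Hw. rewrite app_nil_r. apply den_var in Hw.
  apply den_under. intros a Ha. apply den_over. intros b Hb.
  apply den_word in Ha, Hb.
  apply den_closed. intros x y K.
  pose proof (closure_app _ _ _ _ (closure_app _ _ _ _ Ha Hw) Hb) as H.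
  rewrite <- app_assoc in H. apply H. intros ? <-. apply (accepted_rule p u); auto.
  apply K. apply den_prod; [|apply den_word_self].
  apply rules_rhs in Hu. destruct (rhs u); simpl; congruence.
Qed.

(** The goal is generated by words starting in the closure of [SHalt]; all of them are accepted, and
    the empty context passes this on to the closure. *)
Lemma goal_accepted w : Den (goal s p) w -> accepted p w.
Proof.
  unfold goal. destruct (stoup s p) as [|R l].
  - intros H. apply den_sym_form in H. specialize (H [] []). simpl in H.
    rewrite app_nil_r in H. apply H. intros ? <-. apply (accepted_halt p []).
  - intros H. specialize (H [] []). simpl in H. rewrite app_nil_r in H.
    apply H. intros ? (u & v & -> & Hu & _). rewrite app_nil_r.
    apply den_sym_form in Hu. apply (Hu [] v). intros ? <-. apply (accepted_halt p []).
Qed.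

(** Every [!R] contains the empty word because [R] is valid; these empty words are fed to the
    implications. *)
Lemma machine_form_goal w : Den (machine_form s p) w -> Den (goal s p) w.
Proof.
  assert (Hv : forall R, In R (stoup s p) -> valid (accepted p) val R).
  { intros R HR. apply in_map_iff in HR. destruct HR as (u & <- & Hu).
    now apply rule_form_valid. }
  unfold machine_form. revert Hv. generalize (goal s p) as C.
  induction (stoup s p) as [|R l IH]; simpl; intros C Hv H; auto.
  apply IH; auto. apply (H []). apply closure_in. split; auto. apply Hv; auto.
Qed.

Lemma word_stoups w : flat_map stoups (word_terms s w) = [].
Proof. induction w; simpl; auto. Qed.

Lemma word_yield w : flat_map yield (word_terms s w) = map (sym_form s) w.
Proof. induction w; simpl; congruence. Qed.

Lemma machine_sequent_sound n :
  deriv s (machine_sequent s p n) -> halts p (init n).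
Proof.
  intros H. pose (w := config_word [] (SState 0) (repeat 0 n)).
  assert (Ha : accepted p w).
  { apply goal_accepted, machine_form_goal.
    apply (deriv_sound (accepted p) val s _ H).
    unfold machine_sequent. cbn [fst snd]. fold w. split; cbn [fst snd].
    - now rewrite word_stoups.
    - rewrite word_yield. apply den_word_self. }
  specialize (Ha [] (SState 0) (repeat 0 n) eq_refl eq_refl). simpl in Ha.
  now rewrite init_counts.
Qed.
End Soundness.

(** * Halting computations give derivations *)

Section Completeness.
Variables (s : system) (p : program).

Lemma teq_refl_for l : Forall2 teq (map TFor l) (map TFor l).
Proof. induction l; simpl; constructor; auto using teq. Qed.

Lemma deriv_perm z z' l C : Permutation z z' ->
  deriv s ((z, map TFor l), C) -> deriv s ((z', map TFor l), C).
Proof. intros Hz H. eapply d_perm; [exact H|]. split; [exact Hz|apply teq_refl_for]. Qed.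

Lemma deriv_prodL z G1 G2 l C : l <> [] ->
  deriv s ((z, G1 ++ map TFor l ++ G2), C) -> deriv s ((z, G1 ++ TFor (prod_form l) :: G2), C).
Proof.
  revert G1; induction l as [|A l IH]; intros G1 Hl H; [congruence|].
  destruct l as [|B l]; [exact H|].
  apply (d_prodL s CHole z G1 G2 A (prod_form (B :: l))). simpl fill.
  change (G1 ++ TFor A :: ?G) with (G1 ++ [TFor A] ++ G). rewrite app_assoc.
  apply IH; [discriminate|]. now rewrite <- app_assoc.
Qed.

Lemma deriv_underL z G1 G2 l F C :
  deriv s ((z, G1 ++ TFor F :: G2), C) ->
  deriv s ((z, G1 ++ map TFor l ++ TFor (under_form l F) :: G2), C).
Proof.
  revert G1 F; induction l as [|A l IH]; intros G1 F H; [exact H|].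
  simpl. change (G1 ++ TFor A :: ?G) with (G1 ++ [TFor A] ++ G). rewrite app_assoc.
  apply IH. rewrite <- app_assoc.
  apply (d_underL s CHole [] z [TFor A] G1 G2 A F C); [apply d_ax|exact H].
Qed.

Lemma deriv_overL z G1 G2 l F C :
  deriv s ((z, G1 ++ TFor F :: G2), C) ->
  deriv s ((z, G1 ++ TFor (over_form l F) :: map TFor l ++ G2), C).
Proof.
  revert G2 F; induction l as [|A l IH]; intros G2 F H; [exact H|].
  simpl.
  apply (d_overL s CHole [] z [TFor A] G1 (map TFor l ++ G2) A (over_form l F) C);
    [apply d_ax|]. now apply IH.
Qed.

(** Read upwards: contraction copies the rule into a bracket around the state, [!P] places the copy
    to the right of the state, left implication consumes the state, and the left rule for [FBoxI]
    removes the bracket. *)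
Lemma deriv_fire z l1 l2 q F C :
  is_state q = true ->
  In (FUnder (FVar (sym_code q)) (FBoxI F)) z ->
  deriv s ((z, map TFor l1 ++ TFor F :: map TFor l2), C) ->
  deriv s ((z, map TFor l1 ++ TFor (sym_form s q) :: map TFor l2), C).
Proof.
  intros Hq HR H. set (R := FUnder _ _) in HR.
  apply in_split in HR. destruct HR as (z1 & z2 & ->).
  assert (P : Permutation (z1 ++ R :: z2) ((z1 ++ z2) ++ [R])).
  { rewrite <- Permutation_middle. apply Permutation_cons_append. }
  set (z := z1 ++ z2) in *. clearbody z.
  change (deriv s ((z1 ++ R :: z2, map TFor l1 ++ map TFor (sym_form s q :: l2)), C)).
  change (deriv s ((z1 ++ R :: z2, map TFor l1 ++ map TFor (F :: l2)), C)) in H.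
  rewrite <- map_app in *. apply (deriv_perm _ _ _ _ P) in H.
  apply (deriv_perm _ _ _ _ (Permutation_sym P)).
  rewrite map_app in *. simpl map in *.
  set (G1 := map TFor l1) in *. set (G2 := map TFor l2) in *. clearbody G1 G2.
  set (x := FVar (sym_code q)) in *.
  assert (K : deriv s ((z ++ [R], G1 ++ TBr [R] [TFor x] :: G2), C)).
  { apply (d_bangP s (CIn (z ++ [R]) G1 CHole G2) [] [TFor x] [] R).
    apply (d_underL s (CIn (z ++ [R]) G1 CHole G2) [] [] [TFor x] [] [] x (FBoxI F));
      [apply d_ax|].
    apply (d_boxiL s CHole (z ++ [R]) G1 G2 F). exact H. }
  (* Both diamonds open into the double bracket that contraction turns into a single one; its
     content [x] meets the side condition of [S2018minus]. *)
  assert (K18 : s <> S2015 -> deriv s ((z ++ [R], G1 ++ TFor (FDia (FDia x)) :: G2), C)).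
  { intros Hs. apply (d_diaL s CHole). simpl.
    apply (d_diaL s (CIn (z ++ [R]) G1 CHole G2) [] [] []). simpl.
    apply (d_bangC2018 s CHole z [] R G1 [TFor x] G2); auto.
    left. discriminate. }
  unfold sym_form. rewrite Hq. fold x.
  destruct s eqn:Es; [|now apply K18|now apply K18].
  apply (d_bangC2015 S2015 CHole z [R] [] G1 [TFor x] G2); auto. discriminate.
Qed.

(** * Derivations along a run *)

Let derivable (w : list sym) : Prop :=
  deriv s ((stoup s p, word_terms s w), goal s p).

Lemma word_terms_map w : word_terms s w = map TFor (map (sym_form s) w).
Proof. unfold word_terms. now rewrite map_map. Qed.

(** After firing, the rule body stands in place of [q]; it consumes [l] and [r] on its two sides and
    leaves the product of [v], which is then split. *)
Lemma derivable_rule l q r v X Y w w' :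
  In (Rule l q r v) (rules p) ->
  w = X ++ l ++ q :: r ++ Y -> w' = X ++ v ++ Y -> derivable w' -> derivable w.
Proof.
  intros Hu -> -> H. unfold derivable in *. rewrite word_terms_map in *.
  rewrite !map_app, app_assoc, <- map_app. simpl map.
  apply (deriv_fire _ _ _ q (rule_body s (Rule l q r v))).
  - exact (rules_state p _ Hu).
  - exact (in_map (rule_form s) _ _ Hu).
  - unfold rule_body; simpl. rewrite !map_app, <- app_assoc.
    apply deriv_underL, deriv_overL, deriv_prodL.
    + apply rules_rhs in Hu. simpl in Hu. destruct v; simpl; congruence.
    + now rewrite !map_app in H.
Qed.

Lemma deriv_prodR A l : deriv s (([], map TFor (A :: l)), prod_form (A :: l)).
Proof.
  revert A; induction l as [|B l IH]; intros A; [apply d_ax|].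
  apply (d_prodR s [] [] [TFor A]); [apply d_ax|apply IH].
Qed.

Lemma deriv_bangP_all z l k C :
  deriv s ((z, map TFor (l ++ k)), C) -> deriv s ((z ++ k, map TFor l), C).
Proof.
  revert z l; induction k as [|A k IH]; intros z l H; rewrite ?app_nil_r in *; auto.
  apply (deriv_perm ((z ++ k) ++ [A])).
  { rewrite <- Permutation_cons_append. apply Permutation_middle. }
  rewrite <- (app_nil_r (map TFor l)).
  apply (d_bangP s CHole). simpl fill.
  change [TFor A] with (map TFor [A]). rewrite <- map_app. apply IH.
  now rewrite <- app_assoc.
Qed.

Lemma derivable_halt : derivable [SHalt].
Proof.
  apply (deriv_bangP_all [] [sym_form s SHalt] (stoup s p)). apply deriv_prodR.
Qed.

Let small (w : list nat) : Prop := Forall (fun r => r < nregs p) w.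

Lemma halt_rule_in u : In u (halt_rules p) -> In u (rules p).
Proof. intros H. apply in_or_app. now left. Qed.

Lemma move_rule_in i u : i <= length p -> In u (move_rules p i) -> In u (rules p).
Proof.
  intros Hi H. apply in_or_app. right. apply in_flat_map. exists i.
  split; [apply in_seq; lia|]. apply in_or_app. now left.
Qed.

Lemma instr_rule_in i u : i <= length p -> In u (instr_rules p i) -> In u (rules p).
Proof.
  intros Hi H. apply in_or_app. right. apply in_flat_map. exists i.
  split; [apply in_seq; lia|]. apply in_or_app. now right.
Qed.

Lemma derivable_halting w : small w -> derivable (config_word [] (SState (length p)) w).
Proof.
  intros Hw.
  eapply (derivable_rule [] (SState (length p)) [] [SHalt] [SLeft]);
    [apply halt_rule_in; simpl; tauto|reflexivity|reflexivity|].
  eapply (derivable_rule [SLeft] SHalt [] [SHalt] []);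
    [apply halt_rule_in; simpl; tauto|reflexivity|reflexivity|]. simpl.
  induction Hw as [|r w Hr Hw IH]; simpl.
  - eapply (derivable_rule [] SHalt [SRight] [SHalt] [] []);
      [apply halt_rule_in; simpl; tauto|reflexivity|reflexivity|].
    apply derivable_halt.
  - eapply (derivable_rule [] SHalt [SLetter r] [SHalt] []);
      [apply halt_rule_in|reflexivity|reflexivity|exact IH].
    do 3 right. apply (in_map (fun r => Rule [] SHalt [SLetter r] [SHalt])).
    apply in_seq. lia.
Qed.

Lemma derivable_move_right i x u y : i <= length p -> small u ->
  derivable (config_word (x ++ u) (SState i) y) ->
  derivable (config_word x (SState i) (u ++ y)).
Proof.
  intros Hi Hu. revert x; induction Hu as [|r u Hr Hu IH]; intros x H.
  - now rewrite app_nil_r in H.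
  - eapply (derivable_rule [] (SState i) [SLetter r] [SLetter r; SState i]
      (SLeft :: map SLetter x) (map SLetter (u ++ y) ++ [SRight])).
    + apply (move_rule_in i); auto. apply in_flat_map. exists r.
      split; [apply in_seq; lia|simpl; tauto].
    + config_eq.
    + reflexivity.
    + replace (_ ++ _) with (config_word (x ++ [r]) (SState i) (u ++ y)) by config_eq.
      apply IH. now rewrite <- app_assoc.
Qed.

Lemma derivable_move_left i x y : i <= length p -> small x ->
  derivable (config_word [] (SState i) (x ++ y)) ->
  derivable (config_word x (SState i) y).
Proof.
  intros Hi. revert y; induction x as [|r x IH] using rev_ind; intros y Hx H; auto.
  unfold small in Hx. rewrite Forall_app in Hx. destruct Hx as [Hx Hr].
  inversion Hr; subst.
  eapply (derivable_rule [SLetter r] (SState i) [] [SState i; SLetter r]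
      (SLeft :: map SLetter x) (map SLetter y ++ [SRight])).
  - apply (move_rule_in i); auto. apply in_flat_map. exists r.
    split; [apply in_seq; lia|simpl; tauto].
  - config_eq.
  - reflexivity.
  - replace (_ ++ _) with (config_word x (SState i) (r :: y)) by config_eq.
    apply IH; auto. now rewrite <- app_assoc in H.
Qed.

Lemma derivable_test_right i r j x u :
  nth_error p i = Some (Dec r j) -> small u -> ~ In r u ->
  derivable (config_word (x ++ u) (STest i) []) ->
  derivable (config_word x (STest i) u).
Proof.
  intros E Hu Hr.
  assert (Hi : i < length p) by (apply nth_error_Some; congruence).
  revert x; induction Hu as [|t u Ht Hu IH]; intros x H.
  - now rewrite app_nil_r in H.
  - eapply (derivable_rule [] (STest i) [SLetter t] [SLetter t; STest i]
      (SLeft :: map SLetter x) (map SLetter u ++ [SRight])).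
    + apply (instr_rule_in i); [lia|]. unfold instr_rules. rewrite E. do 3 right.
      apply (in_map (fun t => Rule [] (STest i) [SLetter t] [SLetter t; STest i])).
      apply filter_In. split; [apply in_seq; lia|].
      destruct (Nat.eqb_spec t r); auto. subst. simpl in Hr. tauto.
    + config_eq.
    + reflexivity.
    + replace (_ ++ _) with (config_word (x ++ [t]) (STest i) u) by config_eq.
      apply IH; [simpl in Hr; tauto|]. now rewrite <- app_assoc.
Qed.

Lemma reg_small i c : nth_error p i = Some c -> reg_of c < nregs p.
Proof.
  intros E. apply nth_error_In in E. unfold nregs.
  pose proof (list_max_le (map reg_of p) (list_max (map reg_of p))) as [H _].
  specialize (H (le_n _)). rewrite Forall_forall in H.
  specialize (H (reg_of c) (in_map reg_of _ _ E)). lia.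
Qed.

Lemma clamp_le i : i <= length p -> clamp p i = i.
Proof. apply Nat.min_l. Qed.

(** Between instructions the state rests at the left marker, the only place where zero tests can
    start. *)
Lemma derivable_run k i w : small w -> halted p (run p k (i, counts w)) ->
  derivable (config_word [] (SState (clamp p i)) w).
Proof.
  revert i w; induction k as [|k IH]; intros i w Hw Hk.
  { unfold halted in Hk. simpl in Hk. unfold clamp. rewrite Nat.min_r by lia.
    now apply derivable_halting. }
  destruct (Nat.le_gt_cases (length p) i) as [Hi|Hi].
  { unfold clamp. rewrite Nat.min_r by lia. now apply derivable_halting. }
  rewrite clamp_le by lia.
  change (run p (S k) (i, counts w)) with (run p k (step p (i, counts w))) in Hk.
  destruct (nth_error p i) as [[r|r j]|] eqn:E.
  - rewrite (step_inc _ _ _ _ E) in Hk. apply IH in Hk.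
    2:{ constructor; auto. exact (reg_small _ _ E). }
    rewrite clamp_le in Hk by lia.
    eapply (derivable_rule [] (SState i) [] [SState (S i); SLetter r] [SLeft]);
      [|reflexivity|reflexivity|exact Hk].
    apply (instr_rule_in i); [lia|]. unfold instr_rules. rewrite E. simpl. tauto.
  - destruct (in_dec Nat.eq_dec r w) as [Hr|Hr].
    (* The state walks to an occurrence of [r], deletes it and walks back. *)
    + apply in_split in Hr. destruct Hr as (x & y & ->).
      rewrite (step_dec _ _ _ _ _ _ E) in Hk.
      apply Forall_app in Hw. destruct Hw as [Hx Hy]. inversion Hy; subst.
      apply IH in Hk; [|apply Forall_app; now split].
      rewrite clamp_le in Hk by lia.
      apply derivable_move_right; [lia|auto|].
      eapply (derivable_rule [] (SState i) [SLetter r] [SState (S i)]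
        (SLeft :: map SLetter x) (map SLetter y ++ [SRight])).
      * apply (instr_rule_in i); [lia|]. unfold instr_rules. rewrite E. simpl. tauto.
      * config_eq.
      * reflexivity.
      * replace (_ ++ _) with (config_word x (SState (S i)) y) by config_eq.
        apply derivable_move_left; auto.
    (* The test scans the whole word, and the state of the jump target walks back. *)
    + rewrite (step_zero _ _ _ _ _ E Hr) in Hk. apply IH in Hk; auto.
      eapply (derivable_rule [SLeft] (SState i) [] [SLeft; STest i] []);
        [|reflexivity|reflexivity|].
      { apply (instr_rule_in i); [lia|]. unfold instr_rules. rewrite E. simpl. tauto. }
      apply (derivable_test_right i r j []); auto. simpl app.
      eapply (derivable_rule [] (STest i) [SRight] [SState (clamp p j); SRight]
        (SLeft :: map SLetter w) []).
      * apply (instr_rule_in i); [lia|]. unfold instr_rules. rewrite E. simpl. tauto.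
      * config_eq.
      * reflexivity.
      * replace (_ ++ _) with (config_word w (SState (clamp p j)) []) by config_eq.
        apply derivable_move_left; auto; [apply Nat.le_min_r|]. now rewrite app_nil_r.
  - apply nth_error_None in E. lia.
Qed.

(** Each [!R] comes to the left end and drops into the stoup. The condition on [G] provides the
    nonempty antecedent required in [S2018minus]. *)
Lemma deriv_bang_stoup z k G C : G <> [] ->
  deriv s ((z ++ k, G), C) ->
  deriv s ((z, G), fold_right (fun R C => FUnder (FBang R) C) C k).
Proof.
  intros HG. revert z; induction k as [|R k IH]; intros z H; simpl.
  - now rewrite app_nil_r in H.
  - apply d_underR; auto. apply (d_bangL s CHole z [] G R). simpl. apply IH.
    now rewrite <- app_assoc.
Qed.

Lemma machine_sequent_complete n : halts p (init n) -> deriv s (machine_sequent s p n).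
Proof.
  intros [k Hk]. apply deriv_bang_stoup; [discriminate|].
  rewrite <- (clamp_le 0) by lia. apply (derivable_run k).
  - apply Forall_forall. intros r Hr. apply repeat_spec in Hr. subst. apply Nat.lt_0_succ.
  - now rewrite <- init_counts.
Qed.
End Completeness.

(** * Undecidability *)

Lemma enc_list_repeat {X} (e : X -> nat) x n l :
  enc_list e (repeat x n ++ l) = Nat.iter n (fun y => S (cpair (e x) y)) (enc_list e l).
Proof. induction n as [|n IH]; [reflexivity|]. cbn [repeat app enc_list]. now rewrite IH. Qed.

Lemma enc_machine_sequent s p n :
  let k a := enc_t (TFor (sym_form s a)) in
  n = enc_f (machine_form s p) ->
  enc_seq (machine_sequent s p n) =
    code_fun (k SLeft) (k (SState 0)) (k (SLetter 0)) (k SRight) n.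
Proof.
  intros k Hn. unfold machine_sequent, enc_seq, code_fun. rewrite <- Hn.
  do 2 f_equal. unfold config_word, word_terms.
  cbn [map app]. rewrite map_app, !map_repeat. cbn [enc_list map].
  now rewrite enc_list_repeat.
Qed.

Lemma fok_sym b s a : fok b (sym_form s a) = true.
Proof. unfold sym_form. now destruct (is_state a), s. Qed.

Lemma fok_syms b s w : forallb (fok b) (map (sym_form s) w) = true.
Proof. induction w; simpl; [|rewrite fok_sym]; auto. Qed.

Lemma fok_prod b l : forallb (fok b) l = true -> fok b (prod_form l) = true.
Proof.
  induction l as [|A l IH]; [reflexivity|]. cbn [forallb]. intros H.
  apply andb_prop in H. destruct H as [HA Hl].
  destruct l; [exact HA|]. change (fok b A && fok b (prod_form (f :: l)) = true).
  now rewrite HA, IH.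
Qed.

Lemma fok_under b l C : forallb (fok b) l = true -> fok b C = true ->
  fok b (under_form l C) = true.
Proof.
  revert C; induction l as [|A l IH]; simpl; intros C Hl HC; auto.
  apply andb_prop in Hl. destruct Hl as [HA Hl]. apply IH; simpl; auto. now rewrite HA.
Qed.

Lemma fok_over b l C : forallb (fok b) l = true -> fok b C = true ->
  fok b (over_form l C) = true.
Proof.
  induction l as [|A l IH]; simpl; intros Hl HC; auto.
  apply andb_prop in Hl. destruct Hl as [HA Hl]. now rewrite HA, IH.
Qed.

Lemma fok_stoup b s p : forallb (fok b) (stoup s p) = true.
Proof.
  unfold stoup. induction (rules p) as [|u l IH]; [reflexivity|].
  cbn [map forallb]. rewrite IH, andb_true_r.
  apply fok_under; [apply fok_syms|]. apply fok_over; [apply fok_syms|].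
  apply fok_prod, fok_syms.
Qed.

Lemma machine_sequent_in_fragment s p n : in_fragment s (machine_sequent s p n).
Proof.
  split; [reflexivity|]. split.
  - induction (config_word _ _ _) as [|a w IH]; [reflexivity|].
    cbn [word_terms map forallb]. rewrite andb_true_intro; auto. split; [apply fok_sym|exact IH].
  - unfold machine_form.
    assert (HC : fok (one_allowed s) (goal s p) = true).
    { apply fok_prod. cbn [forallb]. now rewrite fok_sym, fok_stoup. }
    pose proof (fok_stoup (one_allowed s) s p) as Hk.
    induction (stoup s p) as [|R k IH]; [exact HC|].
    cbn [forallb] in Hk. apply andb_prop in Hk. destruct Hk as [HR Hk].
    cbn [fold_right fok]. now rewrite HR, IH.
Qed.

Lemma derivability_undecidable s : ~ derivability_decidable s.
Proof.
  intros [p Hp].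
  pose (k a := enc_t (TFor (sym_form s a))).
  (* The letter codes depend on [s] only, so [d] is fixed before the code [n] of its own formula is
     formed. *)
  pose (d := diag (k SLeft) (k (SState 0)) (k (SLetter 0)) (k SRight) p).
  pose (n := enc_f (machine_form s d)).
  specialize (Hp (machine_sequent s d n) (machine_sequent_in_fragment s d n)).
  rewrite (enc_machine_sequent s d n eq_refl) in Hp.
  apply diag_halts in Hp. destruct Hp as [H1 H2].
  (* Derivability would make [d] both loop and halt on [n]; underivability makes it halt, which
     yields a derivation. *)
  assert (Hn : ~ deriv s (machine_sequent s d n)).
  { intros H. exact (H1 H (machine_sequent_sound s d n H)). }
  exact (Hn (machine_sequent_complete s d n (H2 Hn))).
Qed.

Theorem theorem7 :
  ~ derivability_decidable S2015 /\
  ~ derivability_decidable S2018 /\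
  ~ derivability_decidable S2018minus.
Proof. repeat split; apply derivability_undecidable. Qed.
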